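(* Let $\Phi:\mathcal{D}\to\mathbb{CP}^n$ be an analytic curve on the unit disc $\mathcal{D}\subset\mathbb{C}$ which has a holomorphic lifting $f:\mathcal{D}\to\mathbb{C}^{n+1}\setminus\{0\}$ with $f,f',\ldots,f^{(n)}$ linearly independent, and let $\kappa_0,\ldots,\kappa_{n-1}$ be its Schwarzian curvatures. The quantities $\kappa_0,\ldots,\kappa_{n-1}$ are invariant under projective transformations in $\mathbb{CP}^n$, or equivalently, under affine non-singular transformations of $\mathbb{C}^{n+1}$. That is, if $A:\mathbb{C}^{n+1}\to\mathbb{C}^{n+1}$ is an affine non-singular transformation (a non-singular linear part plus a constant part) and $\tilde f=A\circ f$, then the Schwarzian curvatures $\tilde\kappa_0,\ldots,\tilde\kappa_{n-1}$ formed from $\tilde f$ satisfy $\tilde\kappa_i=\kappa_i$ for $i=0,\ldots,n-1$.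
   Context: A lifting of $\Phi$ is a holomorphic $f:\mathcal{D}\to\mathbb{C}^{n+1}\setminus\{0\}$ with $\Phi(z)=[f(z)]$; two liftings are equivalent if and only if they differ by multiplication by a nowhere-zero analytic function. Given $f$ with $f,f',\ldots,f^{(n)}$ linearly independent, there is an analytic $\lambda:\mathcal{D}\to\mathbb{C}\setminus\{0\}$ with $\lambda^{n+1}\det[f,f',\ldots,f^{(n)}]=1$ (vectors written as columns). Put $\nu=\lambda f$, so that $\det[\nu,\nu',\ldots,\nu^{(n)}]=1$. Differentiating gives $\det[\nu,\nu',\ldots,\nu^{(n-1)},\nu^{(n+1)}]=0$, hence $$\nu^{(n+1)}=\kappa_0\nu+\kappa_1\nu'+\cdots+\kappa_{n-1}\nu^{(n-1)}$$ for functions $\kappa_0,\ldots,\kappa_{n-1}$ on $\mathcal{D}$, which are called the Schwarzian curvatures of $\Phi$.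
   Formalization: For affine A with a nonzero constant part the claim is false in general; it is proved for A such that A∘f is a lifting of P∘Φ for some projective transformation P. Projective transformations and non-singular linear maps are covered in full. *)

(* Defs.v *)
From mathcomp Require Import all_boot all_order all_algebra.
From mathcomp Require Import all_classical all_reals all_analysis.
From mathcomp Require Import complex.

Set Implicit Arguments.
Unset Strict Implicit.
Unset Printing Implicit Defensive.

Import Order.TTheory GRing.Theory Num.Theory numFieldNormedType.Exports.

Local Open Scope classical_set_scope.
Local Open Scope ring_scope.

(* The cast to [numFieldType] is what makes the topology and the norm of
   MathComp-Analysis available on [R[i]]; derivatives along this field are
   complex derivatives. *)
Definition cplx (R : realType) : numFieldType := (complex R : numFieldType).

Definition unit_disc (R : realType) : set (cplx R) := [set z | `|z| < 1].

(* Functions on the disc are total functions whose values outside the disc are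
   never used; since the disc is open, neither do their derivatives at points
   of the disc depend on those values. *)
Definition holomorphic_on_disc (R : realType) (V : normedModType (cplx R))
    (f : cplx R -> V) : Prop :=
  forall z, unit_disc z -> derivable f z 1.

(* CP^n: the lines through the origin of C^(n+1). *)
Definition projective_space (R : realType) (n : nat) : Type :=
  {l : {vspace 'cV[cplx R]_n.+1} | \dim l == 1%N}.

Definition projective_transformation (R : realType) (n : nat)
    (P : projective_space R n -> projective_space R n) : Prop :=
  exists2 M : 'M[cplx R]_n.+1, M \in unitmx
    & forall l, val (P l) = (linfun (mulmx M) @: val l)%VS.

Definition affine_nonsingular (R : realType) (n : nat)
    (A : 'cV[cplx R]_n.+1 -> 'cV[cplx R]_n.+1) : Prop :=
  exists (L : 'M[cplx R]_n.+1) (b : 'cV[cplx R]_n.+1),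
    L \in unitmx /\ forall x, A x = L *m x + b.

Definition is_lifting (R : realType) (n : nat)
    (Phi : cplx R -> projective_space R n)
    (f : cplx R -> 'cV[cplx R]_n.+1) : Prop :=
  holomorphic_on_disc f /\
  forall z, unit_disc z -> f z != 0 /\ val (Phi z) = <[f z]>%VS.

(* Linear independence is required at every point of the disc: this is what
   makes a nowhere-zero normalizing factor possible. *)
Definition nondegenerate_lifting (R : realType) (n : nat)
    (f : cplx R -> 'cV[cplx R]_n.+1) : Prop :=
  forall z, unit_disc z -> free [seq derive1n k f z | k <- iota 0 n.+1].

Definition wronskian_mx (R : realType) (n : nat)
    (f : cplx R -> 'cV[cplx R]_n.+1) (z : cplx R) : 'M[cplx R]_n.+1 :=
  \matrix_(i, j) (derive1n j f z) i 0.

Definition normalizing_factor (R : realType) (n : nat)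
    (f : cplx R -> 'cV[cplx R]_n.+1) (lambda : cplx R -> cplx R) : Prop :=
  holomorphic_on_disc lambda /\
  forall z, unit_disc z ->
    lambda z != 0 /\ lambda z ^+ n.+1 * \det (wronskian_mx f z) = 1.

Definition normalized_lift (R : realType) (n : nat)
    (lambda : cplx R -> cplx R) (f : cplx R -> 'cV[cplx R]_n.+1) :
    cplx R -> 'cV[cplx R]_n.+1 :=
  fun z => lambda z *: f z.

(* [kappa] is the tuple of curvatures formed from [f]. It is a relation because
   the normalizing factor is determined only up to an (n+1)-st root of unity. *)
Definition curvatures_from (R : realType) (n : nat)
    (f : cplx R -> 'cV[cplx R]_n.+1)
    (kappa : 'I_n -> cplx R -> cplx R) : Prop :=
  exists2 lambda : cplx R -> cplx R, normalizing_factor f lambda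
    & forall z, unit_disc z ->
        derive1n n.+1 (normalized_lift lambda f) z =
        \sum_(i < n) kappa i z *: derive1n i (normalized_lift lambda f) z.

Definition schwarzian_curvatures (R : realType) (n : nat)
    (Phi : cplx R -> projective_space R n)
    (kappa : 'I_n -> cplx R -> cplx R) : Prop :=
  exists f : cplx R -> 'cV[cplx R]_n.+1,
    [/\ is_lifting Phi f, nondegenerate_lifting f & curvatures_from f kappa].

Definition equal_on_disc (R : realType) (n : nat)
    (kappa1 kappa2 : 'I_n -> cplx R -> cplx R) : Prop :=
  forall (i : 'I_n) z, unit_disc z -> kappa1 i z = kappa2 i z.

(* Main.v *)
Require Import Defs.
From mathcomp Require Import all_boot all_order all_algebra.
From mathcomp Require Import all_classical all_reals all_analysis.
From mathcomp Require Import complex zify ring lra.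

(** If [g = mu M f] with [M] invertible and [mu] nowhere zero, then
    [det W(g) = mu^(n+1) det M det W(f)]; hence for normalizing factors
    [lambda_f], [lambda_g] the function [t = lambda_g mu / lambda_f] has constant
    power [t^(n+1)], so it is constant and the two normalized lifts satisfy
    [nu_g = c M nu_f] for a constant [c]. Both then satisfy the same equation, and
    its coefficients are determined because [det W(nu_f) = 1]. An affine map
    enters only through the assumption that [A f] still lifts the transformed
    curve, which forces [A f = mu M f].

    To differentiate [lambda] up to [n] times one needs that the components of
    [f], which are twice complex derivable when [n >= 2], are smooth. This is
    obtained without integration: second order expansions give the maximum
    principle, with finitely many bounded singularities allowed; applied to
    [w |-> f[w, x_1, ..., x_k]] it bounds the divided differences of [f] of every
    order; and bounded divided differences of all orders imply derivability and
    pass to the derivative. *)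
Set Implicit Arguments.
Unset Strict Implicit.
Unset Printing Implicit Defensive.

Import Order.TTheory GRing.Theory Num.Theory numFieldNormedType.Exports.

Local Open Scope classical_set_scope.
Local Open Scope ring_scope.
Local Open Scope complex_scope.

(** * Complex derivatives *)

Section ComplexTopology.
Variable R : realType.
Local Notation C := (cplx R).

(** Freeness of the derivatives guarantees [n] derivatives of [f] and no more, and [lambda] is only
    assumed to be derivable once, whereas the formula for the Wronskian of [lambda *: f]
    differentiates [lambda] up to order [n]. As [lambda ^+ n.+1] is the inverse of a Wronskian,
    which already contains derivatives of order [n], differentiating it [n] times calls for
    derivatives of [f] up to order [2n]. For [n <= 1] holomorphy of [lambda] is enough; for [n >= 2]
    the first derivative of [f] is itself derivable, so a second order expansion is available at
    every point, and smoothness is built on that alone.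

    The given [kappa] comes from some lifting [f0], which may differ from [f], so every other
    lifting is compared with [f0]. The factor [mu] is then chosen point by point; its regularity is
    recovered afterwards from quotients of coordinates. Each equivalence has two halves: uniqueness
    of the coefficients gives one, and for the other a normalizing factor is written down with the
    help of an (n+1)-st root of [\det M]. *)

Lemma gt0_complexE (e : C) : 0 < e -> (0 < complex.Re e) /\ e = (complex.Re e)%:C.
Proof.
case: e => x y; rewrite /= ltcE /= => /andP[/eqP -> x0]; split=> //.
Qed.

Lemma nbhs_dist_lt (K : numFieldType) (V : normedModType K) (z : V) (e : K) :
  0 < e -> \forall w \near z, `|z - w| < e.
Proof. by move=> e0; apply: (@cvgr_dist_lt K V V (nbhs z) _ id z _ e e0); exact: cvg_id. Qed.

Lemma continuous_complexRe : continuous (@complex.Re R : C -> R).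
Proof.
move=> z. apply/(@cvgrPdist_lt _ _ _ (nbhs z)) => e e0.
have ez : (0 : C) < e%:C by rewrite ltcR.
apply: filterS (nbhs_dist_lt z ez) => w H.
rewrite -ltcR; apply: le_lt_trans H.
rewrite -raddfB; exact: normc_ge_Re.
Qed.

Lemma normc_real (x : R) : `|(x%:C : C)| = `|x|%:C.
Proof. by rewrite normc_def /= expr0n /= addr0 sqrtr_sqr. Qed.

Lemma continuous_real_complex : continuous (fun x : R => x%:C : C).
Proof.
move=> z; apply/cvgrPdist_lt => e /gt0_complexE[e0 ->]; apply: filterS (nbhs_dist_lt z e0) => w H.
by rewrite -rmorphB normc_real ltcR.
Qed.

Definition cdisc (a : C) (r : R) : set C := [set z | `|z - a| <= r%:C].

(** The disc is a closed subset of the image of a real square under [(x, y) |-> a + x + i y], and a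
    product of segments is compact. *)
Lemma compact_cdisc (a : C) (r : R) : compact (cdisc a r).
Proof.
pose f (p : R * R) : C := a + (p.1%:C + 'i * p.2%:C).
have cf : continuous f.
  move=> p; apply: cvgD; first exact: cvg_cst.
  apply: cvgD.
    apply: (continuous_comp (f := fst) (g := fun x : R => x%:C : C)).
      exact: cvg_fst.
    exact: continuous_real_complex.
  apply: cvgM; first exact: cvg_cst.
  apply: (continuous_comp (f := snd) (g := fun x : R => x%:C : C)).
    exact: cvg_snd.
  exact: continuous_real_complex.
have cK : compact (f @` (`[-r, r] `*` `[-r, r])).
  apply: continuous_compact; first exact: continuous_subspaceT.
  by apply: compact_setX; exact: segment_compact.
apply: subclosed_compact cK _.
  rewrite (_ : cdisc a r = (fun z : C => complex.Re `|z - a|) @^-1` [set x | x <= r]); last first.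
    apply/seteqP; split=> z H.
      by change (complex.Re `|z - a| <= r); rewrite -lecR RRe_real // normr_real.
    change (`|z - a| <= r%:C).
    by rewrite -(RRe_real (normr_real (z - a))) lecR.
  apply: closed_comp; last exact: closed_le.
  move=> z _.
  apply: (@continuous_comp C C R (fun z : C => `|z - a|) (@complex.Re R)).
    apply: (@continuous_comp C C C (fun z : C => z - a) (fun z : C => `|z|)).
      by apply: continuousB; [exact: cvg_id | exact: cst_continuous].
    exact: norm_continuous.
  exact: continuous_complexRe.
move=> z; rewrite /cdisc /= => H.
have HR : `|complex.Re (z - a)| <= r.
  by rewrite -lecR; apply: le_trans H; exact: normc_ge_Re.
have HI : `|complex.Im (z - a)| <= r.
  rewrite -lecR; apply: le_trans H.
  have -> : complex.Im (z - a) = - complex.Re ((z - a) * 'i) by rewrite ReiNIm opprK.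
  rewrite normrN; apply: le_trans (normc_ge_Re _) _.
  have i1 : `|('i : C)| = 1 by rewrite normc_def /= expr0n expr1n add0r sqrtr1.
  by rewrite normrM i1 mulr1.
exists (complex.Re (z - a), complex.Im (z - a)).
  by split; rewrite /= in_itv /= -ler_norml.
by rewrite /f /= -complexE addrC subrK.
Qed.

End ComplexTopology.

Section Slope.
Variables (K : numFieldType) (V : normedModType K).
Implicit Types (f P : K -> V) (z : K).

Lemma continuous_atP f z :
  {for z, continuous f} <->
  forall e : K, 0 < e -> exists2 d : K, 0 < d &
    forall w, `|w - z| < d -> `|f w - f z| < e.
Proof.
split=> [cf e e0|H].
  have [d /= d0 dP] := (nbhs_ballP _ _).1 (@cvgr_dist_lt _ _ _ (nbhs z) _ f (f z) cf e e0).
  exists d => // w wz; rewrite distrC; apply: dP.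
  by rewrite -ball_normE /= distrC.
apply/(@cvgrPdist_lt _ _ _ (nbhs z)) => e /H[d d0 dP].
apply/nbhs_ballP; exists d => //= w; rewrite -ball_normE /= => wz.
by rewrite distrC; apply: dP; rewrite distrC.
Qed.

Lemma nearP (P : K -> Prop) z :
  (\forall w \near z, P w) <-> exists2 d : K, 0 < d & forall w, `|w - z| < d -> P w.
Proof.
split=> [/nbhs_ballP[d /= d0 dP]|[d d0 dP]].
  by exists d => // w wz; apply: dP; rewrite -ball_normE /= distrC.
apply/nbhs_ballP; exists d => //= w; rewrite -ball_normE /= => wz.
by apply: dP; rewrite distrC.
Qed.

(** Carathéodory's form of the derivative: the difference quotient, completed by [l] at [z], is
    continuous there. With its converse below it turns product and chain rules into algebra on
    slopes. *)
Lemma is_derive_slope f z l : is_derive z 1 f l ->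
  exists P, [/\ {for z, continuous P}, P z = l &
    forall w, f w = f z + (w - z) *: P w].
Proof.
move=> [fd fl]; exists (fun w => if w == z then l else (w - z)^-1 *: (f w - f z)).
rewrite eqxx; split=> // [|w]; last first.
  case: eqVneq => [->|wz]; first by rewrite subrr scale0r addr0.
  by rewrite scalerA divff ?subr_eq0 // scale1r addrC subrK.
apply/continuous_atP => e e0; rewrite eqxx.
move: fd; rewrite /derivable => fd.
have := fd; rewrite -[lim _]/('D_1 f z) fl => cf.
have [d /= d0 dP] := (nbhs_ballP _ _).1 (@cvgr_dist_lt _ _ _ (0^') _ _ _ cf e e0).
exists d => // w wz; case: eqVneq => [_|nwz]; first by rewrite subrr normr0.
rewrite distrC; have := dP (w - z); rewrite -ball_normE /= sub0r normrN subr_eq0.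
by move=> /(_ wz nwz); rewrite [(w - z)%:A]mulr1 subrK.
Qed.

Lemma slope_is_derive f P z : {for z, continuous P} ->
  (\forall w \near z, f w = f z + (w - z) *: P w) -> is_derive z 1 f (P z).
Proof.
move=> cP fP.
suff H : h^-1 *: ((f \o shift z) (h *: (1 : K)) - f z) @[h --> 0^'] --> P z.
  split; last exact/cvg_lim.
  by apply/cvg_ex; exists (P z).
apply/(cvgrPdist_lt (F := 0^')) => e e0.
have Pe : \forall w \near z, `|P w - P z| < e by apply/nearP; exact: (continuous_atP P z).1 cP e e0.
have [d d0 dP] := (nearP _ _).1 (filterI fP Pe).
apply/nbhs_ballP; exists d => // h; rewrite -ball_normE /= sub0r normrN => hd h0.
rewrite [h%:A]mulr1; have [|-> hP] := dP (h + z); first by rewrite addrK.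
by rewrite (addrC (f z)) !addrK scalerA mulVf // scale1r distrC.
Qed.

Lemma forall_slope_is_derive f P z : {for z, continuous P} ->
  (forall w, f w = f z + (w - z) *: P w) -> is_derive z 1 f (P z).
Proof.
by move=> cP fP; apply: slope_is_derive => //; apply/nearP; exists 1.
Qed.

Lemma derivable_is_derive1 f z : derivable f z 1 -> is_derive z 1 f (derive1 f z).
Proof. by move=> fd; rewrite derive1E; exact: derivableP. Qed.

Lemma is_derive1E f z l : is_derive z 1 f l -> derive1 f z = l.
Proof. by move=> [_ <-]; rewrite derive1E. Qed.

End Slope.

(** * The mean value inequality along complex segments *)

Section MeanValue.
Variable R : realType.
Local Notation C := (cplx R).

Lemma Re_real_mul (x : R) (w : C) : complex.Re (x%:C * w) = x * complex.Re w.
Proof. by case: w => a b /=; rewrite mul0r subr0. Qed.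

Lemma Re_conj_mul (w : C) : complex.Re (w^*%C * w) = complex.Re (`|w| ^+ 2).
Proof. by rewrite sqr_normc mulrC. Qed.

Lemma is_derive_segment (g : C -> C) (c z h : C) (t : R) :
  derivable g (z + t%:C * h) 1 ->
  is_derive t 1 (fun s : R => complex.Re (c * g (z + s%:C * h)) : R)
    (complex.Re (c * (h * derive1 g (z + t%:C * h)))).
Proof.
move=> /derivable_is_derive1/is_derive_slope[P [cP Pt gP]].
pose Q (s : R) := complex.Re (c * (h * P (z + s%:C * h))).
rewrite -Pt -[complex.Re _]/(Q t).
apply: forall_slope_is_derive.
  rewrite /Q; apply: (@continuous_comp R C R (fun s => c * (h * P (z + s%:C * h))) (@complex.Re R)).
    apply: continuousM; first exact: cst_continuous.
    apply: continuousM; first exact: cst_continuous.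
    apply: (@continuous_comp R C C (fun s => z + s%:C * h) P); last by [].
    apply: continuousD; first exact: cst_continuous.
    apply: continuousM; last exact: cst_continuous.
    exact: continuous_real_complex.
  exact: continuous_complexRe.
move=> s; rewrite /= (gP (z + s%:C * h)) /Q.
have -> : z + s%:C * h - (z + t%:C * h) = (s - t)%:C * h by rewrite rmorphB; ring.
rewrite mulrDr raddfD /=; congr (_ + _).
rewrite [RHS]/GRing.scale /= -Re_real_mul; congr complex.Re.
rewrite [_ *: _](_ : _ = (s - t)%:C * h * P (z + s%:C * h)) //.
by ring.
Qed.

Lemma mean_value_norm_le (g : C -> C) (z h : C) (m : R) :
  (forall t : R, 0 <= t <= 1 -> derivable g (z + t%:C * h) 1 /\
     `|derive1 g (z + t%:C * h)| <= m%:C) ->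
  `|g (z + h) - g z| <= m%:C * `|h|.
Proof.
(* Pairing [g] with the conjugate of its own increment [D] gives a real function on the segment
   whose increment is [|D| ^+ 2] and whose derivative is at most [|D| * |h| * m]; the real mean
   value theorem applies, and [|D|] cancels. *)
move=> H; set D := g (z + h) - g z.
pose phi (s : R) : R := complex.Re (D^*%C * g (z + s%:C * h)).
pose dphi (s : R) : R := complex.Re (D^*%C * (h * derive1 g (z + s%:C * h))).
have dP (t : R) : 0 <= t <= 1 -> is_derive t 1 phi (dphi t).
  by move=> /H[gt _]; exact: is_derive_segment.
have [//|t|t|c] := @MVT R phi dphi 0 1 _ _ _.
- by rewrite in_itv /= => /andP[t0 t1]; apply: dP; rewrite !ltW.
- apply: derivable_within_continuous => s; rewrite in_itv /= => /dP[].
  by [].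
rewrite in_itv /= => /andP[c0 c1]; rewrite subr0 mulr1 => E.
have [_ gm] : derivable g (z + c%:C * h) 1 /\ `|derive1 g (z + c%:C * h)| <= m%:C.
  by apply: H; rewrite !ltW.
have E1 : phi 1 - phi 0 = complex.Re (`|D| ^+ 2).
  rewrite /phi -raddfB -mulrBr /= rmorph1 mul1r mul0r addr0 -[g _ - g _]/D.
  exact: Re_conj_mul.
have [D0|D0] := eqVneq D 0.
  rewrite D0 normr0 mulr_ge0 //; apply: le_trans gm; exact: normr_ge0.
have Dp : 0 < `|D| by rewrite normr_gt0.
rewrite -(ler_pM2l Dp) -expr2.
have -> : `|D| ^+ 2 = (complex.Re (`|D| ^+ 2))%:C.
  by rewrite RRe_real // rpredX // normr_real.
rewrite -E1 E; apply: (@le_trans _ _ `|dphi c|%:C).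
  rewrite lecR; exact: ler_norm.
apply: le_trans (normc_ge_Re _) _.
rewrite normrM (_ : `|D^*%C| = `|D|); last exact: normcJ.
by rewrite ler_pM2l // normrM mulrC ler_wpM2r.
Qed.

End MeanValue.

(** * Second order expansions *)

Section Expansion.
Variable R : realType.
Local Notation C := (cplx R).
Implicit Types (f g : C -> C) (z : C).

(** A second order Taylor expansion whose last coefficient is continuous at [z]. It asks nothing
    about derivatives near [z], so it is stable under products and under division by [w - y] for
    [y != z], which is what divided differences require. *)
Definition expansion2 f z := exists al P, {for z, continuous P} /\
  \forall w \near z, f w = f z + al * (w - z) + (w - z) ^+ 2 * P w.

Lemma continuous_subr z y : {for y, continuous (fun w : C => w - z)}.
Proof. by apply: continuousB; [exact: cvg_id | exact: cst_continuous]. Qed.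

Lemma continuous_forC (c : C) z : {for z, continuous (fun _ : C => c)}.
Proof. exact: cst_continuous. Qed.

Lemma continuous_forD f g z : {for z, continuous f} -> {for z, continuous g} ->
  {for z, continuous (fun w => f w + g w)}.
Proof. by move=> cf cg; exact: continuousD cf cg. Qed.

Lemma continuous_forM f g z : {for z, continuous f} -> {for z, continuous g} ->
  {for z, continuous (fun w => f w * g w)}.
Proof. by move=> cf cg; exact: continuousM cf cg. Qed.

Arguments continuous_forC c z [t] _.
Arguments continuous_subr z y [t] _.
Local Notation cC := continuous_forC.
Local Notation cS := continuous_subr.

Lemma slope_is_deriveM f (P : C -> C) z : {for z, continuous P} ->
  (forall w, f w = f z + (w - z) * P w) -> is_derive z 1 f (P z).
Proof. exact: forall_slope_is_derive. Qed.

Lemma is_derive_slopeM f z l : is_derive z 1 f l ->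
  exists P : C -> C, [/\ {for z, continuous P}, P z = l &
    forall w, f w = f z + (w - z) * P w].
Proof. exact: is_derive_slope. Qed.

Lemma expansion2_cst (c : C) z : expansion2 (fun=> c) z.
Proof.
exists 0, (fun=> 0); split; first exact: cst_continuous.
by apply/nearP; exists 1 => // w _; rewrite mul0r mulr0 !addr0.
Qed.

Lemma expansion2M f g z : expansion2 f z -> expansion2 g z ->
  expansion2 (fun w => f w * g w) z.
Proof.
move=> [a [P [cP fP]]] [b [Q [cQ gQ]]].
exists (a * g z + f z * b).
exists (fun w => a * b + f z * Q w + P w * g z + (w - z) * (a * Q w + P w * b)
   + (w - z) ^+ 2 * (P w * Q w)); split.
  have cS2 := continuous_forM (cS z z) (cS z z).
  apply: continuous_forD; last exact: continuous_forM cS2 (continuous_forM cP cQ).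
  apply: continuous_forD; last first.
    exact: continuous_forM (cS z z) (continuous_forD (continuous_forM (cC a z) cQ) (continuous_forM cP (cC b z))).
  apply: continuous_forD; last exact: continuous_forM cP (cC (g z) z).
  exact: continuous_forD (cC (a * b) z) (continuous_forM (cC (f z) z) cQ).
have [d d0 dP] := (nearP _ _).1 (filterI fP gQ).
apply/nearP; exists d => // w /dP[-> ->]; ring.
Qed.

Lemma expansion2_near_eq f g z : expansion2 f z ->
  (\forall w \near z, g w = f w) -> expansion2 g z.
Proof.
move=> [a [P [cP fP]]] gf; exists a, P; split=> //.
have gz : g z = f z.
  by have [d d0 dP] := (nearP _ _).1 gf; apply: dP; rewrite subrr normr0.
have [d d0 dP] := (nearP _ _).1 (filterI fP gf).
by apply/nearP; exists d => // w /dP[fw ->]; rewrite fw gz.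
Qed.

Lemma expansion2_subr f (c : C) z : expansion2 f z -> expansion2 (fun w => f w - c) z.
Proof.
move=> [a [P [cP fP]]]; exists a, P; split=> //.
have [d d0 dP] := (nearP _ _).1 fP.
by apply/nearP; exists d => // w /dP ->; ring.
Qed.

Lemma expansion2_id z : expansion2 (fun w => w) z.
Proof.
exists 1, (fun=> 0); split; first exact: cst_continuous.
by apply/nearP; exists 1 => // w _; rewrite mulr0 addr0 mul1r addrC subrK.
Qed.

Lemma near_neq z y : z != y -> \forall w \near z, w != y.
Proof.
move=> zy; apply/nearP; exists `|z - y|; first by rewrite normr_gt0 subr_eq0.
by move=> w; apply: contraTneq => ->; rewrite distrC ltxx.
Qed.

Lemma expansion2_inv (y z : C) : z != y -> expansion2 (fun w => (w - y)^-1) z.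
Proof.
move=> zy; exists (- (z - y) ^- 2), (fun w => (z - y) ^- 2 * (w - y)^-1); split.
  apply: (continuous_forM (cC _ z)).
  by apply: continuousV; [rewrite subr_eq0 | exact: cS].
have [d d0 dP] := (nearP _ _).1 (near_neq zy).
apply/nearP; exists d => // w /dP wy; field.
by rewrite !subr_eq0 wy zy.
Qed.

Lemma expansion2_continuous f z : expansion2 f z -> {for z, continuous f}.
Proof.
move=> [a [P [cP fP]]].
pose g w := f z + a * (w - z) + (w - z) ^+ 2 * P w.
have cg : {for z, continuous g}.
  have cS2 := continuous_forM (cS z z) (cS z z).
  exact: continuous_forD (continuous_forD (cC (f z) z) (continuous_forM (cC a z) (cS z z))) (continuous_forM cS2 cP).
apply/continuous_atP => e e0.
have ge : \forall w \near z, `|g w - g z| < e.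
  by apply/nearP; exact: (continuous_atP g z).1 cg e e0.
have [d d0 dP] := (nearP _ _).1 (filterI fP ge).
exists d => // w /dP[-> ]; rewrite {2}/g subrr expr0n mulr0 mul0r !addr0.
by [].
Qed.

Lemma slope_bounded f z : expansion2 f z ->
  exists B : C, \forall w \near z, w != z -> `|(f w - f z) / (w - z)| <= B.
Proof.
move=> [a [P [cP fP]]]; pose Q w := a + (w - z) * P w.
have cQ : {for z, continuous Q}.
  exact: continuous_forD (cC a z) (continuous_forM (cS z z) cP).
have Q1 : \forall w \near z, `|Q w - Q z| < 1.
  by apply/nearP; exact: (continuous_atP Q z).1 cQ 1 ltr01.
exists (`|Q z| + 1).
have [d d0 dP] := (nearP _ _).1 (filterI fP Q1).
apply/nearP; exists d => // w /dP[fw Qw] wz.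
have -> : (f w - f z) / (w - z) = Q z + (Q w - Q z).
  by rewrite fw /Q; field; rewrite subr_eq0.
by apply: le_trans (ler_normD _ _) _; rewrite lerD2l ltW.
Qed.

Lemma ge0_ReE (x : C) : 0 <= x -> (complex.Re x)%:C = x.
Proof. by move=> x0; rewrite RRe_real // ger0_real. Qed.

(** After subtraction of the quadratic polynomial with coefficients [l] and [b / 2], the derivative
    at [u] is [(u - z) * (P1 u - b)], small compared with [|u - z|]. The mean value inequality
    integrates this to a remainder that is small compared with [|w - z| ^+ 2]. *)
Lemma derivable2_expansion2 f z :
  (\forall w \near z, derivable f w 1) -> derivable (derive1 f) z 1 ->
  expansion2 f z.
Proof.
move=> fd /derivable_is_derive1/is_derive_slopeM[P1 [cP1 _ f'P]].
pose l := derive1 f z; pose b := P1 z.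
exists l, (fun w => if w == z then b / 2 else (f w - f z - l * (w - z)) / (w - z) ^+ 2).
split; last first.
  apply/nearP; exists 1 => // w _; case: eqVneq => [->|wz].
    by rewrite subrr expr0n mulr0 mul0r !addr0.
  by field; rewrite subr_eq0.
apply/continuous_atP => e e0; rewrite eqxx.
have e2 : 0 < e / 2 by rewrite divr_gt0.
have P1e : \forall w \near z, `|P1 w - P1 z| < e / 2.
  by apply/nearP; exact: (continuous_atP P1 z).1 cP1 _ e2.
have [d d0 dP] := (nearP _ _).1 (filterI fd P1e).
exists d => // w wd; case: eqVneq => [_|wz]; first by rewrite subrr normr0.
pose g u := f u - (l * (u - z) + b / 2 * (u - z) ^+ 2).
have gd u : `|u - z| < d -> is_derive u 1 g (derive1 f u - (l + b * (u - z))).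
  move=> /dP[/derivable_is_derive1/is_derive_slopeM[Q [cQ <- fQ]] _].
  pose S v := Q v - (l + b / 2 * (u - z) + b / 2 * (v - z)).
  have -> : Q u - (l + b * (u - z)) = S u by rewrite /S; field.
  apply: slope_is_deriveM => [|v]; last by rewrite /g /S (fQ v); ring.
  apply: continuousB; first exact: cQ.
  exact: continuous_forD (cC _ u) (continuous_forM (cC _ u) (cS z u)).
pose m := complex.Re (`|w - z| * (e / 2)).
have mE : m%:C = `|w - z| * (e / 2).
  by rewrite ge0_ReE // mulr_ge0 // ltW.
have := @mean_value_norm_le R g z (w - z) m.
rewrite (addrC z) subrK => /(_ _)/wrap[].
  move=> t /andP[t0 t1].
  have tw : `|z + t%:C * (w - z) - z| <= `|w - z|.
    rewrite addrAC subrr add0r normrM normc_real ler_piMl // lecR ger0_norm //.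
  have td := le_lt_trans tw wd.
  have gt := gd _ td; split; first by case: gt.
  have [_ Pu] := dP _ td.
  move: tw Pu; rewrite (is_derive1E gt) mE; move: (z + t%:C * (w - z)) => u tu Pu.
  rewrite f'P -/l (_ : l + (u - z) * P1 u - (l + b * (u - z)) = (u - z) * (P1 u - b)); last by ring.
  by rewrite normrM ler_pM // ltW.
move=> H.
have -> : (f w - f z - l * (w - z)) / (w - z) ^+ 2 - b / 2 = (g w - g z) / (w - z) ^+ 2.
  by rewrite /g; field; rewrite subr_eq0.
rewrite normrM normfV normrX ltr_pdivrMr; last by rewrite exprn_gt0 // normr_gt0 subr_eq0.
apply: le_lt_trans H _; rewrite mE mulrAC -expr2 mulrC ltr_pM2r; last first.
  by rewrite exprn_gt0 // normr_gt0 subr_eq0.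
by rewrite ltr_pdivrMr // ltr_pMr // ltr1n.
Qed.

End Expansion.

(** * The maximum principle *)

Section MaximumPrinciple.
Variable R : realType.
Local Notation C := (cplx R).
Implicit Types (f g : C -> C) (z : C).

(** The norm [|z|] lies in [C], whose order is only partial; a modulus in [R] gives access to total
    order and to real arithmetic. *)
Definition cabs (z : C) : R := complex.Re `|z|.

Lemma cabsE z : `|z| = (cabs z)%:C.
Proof. by rewrite /cabs ge0_ReE. Qed.

Lemma cabs_ge0 z : 0 <= cabs z.
Proof. by rewrite -ler0c -cabsE. Qed.

Lemma cabsM z w : cabs (z * w) = cabs z * cabs w.
Proof. by apply: complexI; rewrite rmorphM -!cabsE normrM. Qed.

Lemma cabsX z n : cabs (z ^+ n) = cabs z ^+ n.
Proof. by apply: complexI; rewrite rmorphXn -!cabsE normrX. Qed.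

Lemma cabsB z w : cabs (z - w) <= cabs z + cabs w.
Proof. by rewrite -lecR rmorphD -!cabsE ler_normB. Qed.

Lemma cabs_eq0 z : (cabs z == 0) = (z == 0).
Proof. by have := normr_eq0 z; rewrite cabsE => <-; rewrite eq_complex /= eqxx andbT. Qed.

Lemma Re_le_cabs z : `|complex.Re z| <= cabs z.
Proof. by rewrite -lecR -cabsE; exact: normc_ge_Re. Qed.

Lemma ReD z w : complex.Re (z + w) = complex.Re z + complex.Re w.
Proof. by case: z; case: w. Qed.

Lemma ReN z : complex.Re (- z) = - complex.Re z.
Proof. by case: z. Qed.

Lemma cabs_real (x : R) : cabs (x%:C) = `|x|.
Proof. by apply: complexI; rewrite -cabsE normc_real. Qed.

Lemma sqr_cabs z : cabs z ^+ 2 = complex.Re z ^+ 2 + complex.Im z ^+ 2.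
Proof. by apply: complexI; rewrite rmorphXn (add_Re2_Im2 z) [`|_|]cabsE. Qed.

Lemma continuous_cabs : continuous (cabs : C -> R).
Proof.
move=> z; apply: (@continuous_comp C C R (fun z : C => `|z|) (@complex.Re R)).
  exact: norm_continuous.
exact: continuous_complexRe.
Qed.

Lemma continuous_at_realP f z : {for z, continuous f} <->
  forall e : R, 0 < e -> exists2 d : R, 0 < d &
    forall w, cabs (w - z) < d -> cabs (f w - f z) < e.
Proof.
rewrite continuous_atP; split=> H e e0.
  have [|d d0 dP] := H e%:C; first by rewrite ltcR.
  have [dR dE] := gt0_complexE d0; exists (complex.Re d) => // w wd.
  by rewrite -ltcR -cabsE dP // cabsE dE ltcR.
have [eR eE] := gt0_complexE e0; have [d d0 dP] := H _ eR.
exists d%:C; first by rewrite ltcR.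
by move=> w; rewrite eE !cabsE !ltcR => /dP.
Qed.

Lemma near_realP (P : C -> Prop) z : (\forall w \near z, P w) <->
  exists2 d : R, 0 < d & forall w, cabs (w - z) < d -> P w.
Proof.
rewrite nearP; split=> -[d d0 dP].
  have [dR dE] := gt0_complexE d0; exists (complex.Re d) => // w wd.
  by apply: dP; rewrite cabsE dE ltcR.
exists d%:C; first by rewrite ltcR.
by move=> w; rewrite cabsE ltcR => /dP.
Qed.

Lemma cdiscE a r z : cdisc a r z <-> cabs (z - a) <= r.
Proof. by rewrite /cdisc /= cabsE lecR. Qed.

(* Summing [u (z + h) <= u z] over [h = t, it, -t, -it] kills the first and
   second order terms of [psi], while the strictly subharmonic term
   contributes [4 e t^2]. *)
Lemma no_interior_max (psi : C -> C) (c a z : C) (e : R) :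
  0 < e -> expansion2 psi z ->
  ~ (\forall w \near z,
      complex.Re (c * psi w) + e * cabs (w - a) ^+ 2 <=
      complex.Re (c * psi z) + e * cabs (z - a) ^+ 2).
Proof.
move=> e0 [al [P [cP psiP]]] umax.
have n0 : 0 < cabs c + 1 by rewrite ltr_wpDl // cabs_ge0.
have en0 : 0 < e / (cabs c + 1) by rewrite divr_gt0.
have Pe : \forall w \near z, cabs (P w - P z) < e / (cabs c + 1).
  by apply/near_realP; exact: (continuous_at_realP P z).1 cP _ en0.
have [d d0 dP] := (near_realP _ _).1 (filterI (filterI psiP Pe) umax).
pose t := d / 2.
have t0 : 0 < t by rewrite divr_gt0.
have td : t < d by rewrite ltr_pdivrMr // ltr_pMr // ltr1n.
have step (o : C) : cabs o = 1 -> complex.Re (c * (al * (t%:C * o))) +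
    t ^+ 2 * (complex.Re (c * (o ^+ 2 * P (z + t%:C * o)))) +
    e * (2 * t * complex.Re ((z - a)^*%C * o) + t ^+ 2) <= 0 /\
    `|complex.Re (c * (P (z + t%:C * o) - P z))| < e.
  move=> o1.
  have [|[-> Po] uo] := dP (z + t%:C * o).
    by rewrite addrAC subrr add0r cabsM o1 mulr1 cabs_real gtr0_norm.
  split; last first.
    apply: le_lt_trans (Re_le_cabs _) _; rewrite cabsM.
    apply: le_lt_trans (_ : _ <= (cabs c + 1) * cabs (P (z + t%:C * o) - P z)) _.
      by rewrite ler_wpM2r ?cabs_ge0 // lerDl.
    by rewrite mulrC -ltr_pdivlMr.
  move: uo; move: (P (z + t%:C * o)) => p.
  have -> : z + t%:C * o - z = t%:C * o by ring.
  have -> : c * (psi z + al * (t%:C * o) + (t%:C * o) ^+ 2 * p) =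
    c * psi z + c * (al * (t%:C * o)) + (t ^+ 2)%:C * (c * (o ^+ 2 * p)).
    by rewrite rmorphXn; ring.
  rewrite !ReD Re_real_mul.
  have -> : cabs (z + t%:C * o - a) ^+ 2 =
    cabs (z - a) ^+ 2 + 2 * t * complex.Re ((z - a)^*%C * o) + t ^+ 2.
    have := sqr_cabs o; rewrite o1 expr1n.
    rewrite !sqr_cabs; clear Po o1; case: o => [k m] /= km.
    case E: (z - a) => [x y].
    have -> : z + t%:C * (k +i* m) - a = (x + t * k) +i* (y + t * m).
      rewrite addrAC E; apply/eqP; rewrite eq_complex /=; apply/andP; split; apply/eqP; ring.
    transitivity (x ^+ 2 + y ^+ 2 + 2 * t * (x * k + y * m) + t ^+ 2 * (k ^+ 2 + m ^+ 2)); first by rewrite /=; ring.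
    by rewrite -km /= mulr1; congr (_ + _ * _ + _); ring.
  move=> H; rewrite -(lerD2l (complex.Re (c * psi z) + e * cabs (z - a) ^+ 2)) addr0.
  apply: le_trans H; rewrite le_eqVlt; apply/orP; left; apply/eqP; ring.
have i1 : cabs ('i : C) = 1.
  by apply/eqP; rewrite -sqrp_eq1 ?cabs_ge0 // sqr_cabs /= expr0n expr1n add0r.
have iN1 : cabs (- 'i : C) = 1 by rewrite -[RHS]i1 /cabs normrN.
have o1 : cabs (1 : C) = 1 by rewrite -[1]/(1%:C) cabs_real normr1.
have oN1 : cabs (- 1 : C) = 1 by rewrite -[RHS]o1 /cabs normrN.
have ii : ('i : C) ^+ 2 = -1 := @sqr_i R.
have [A1 D1] := step _ o1.
have [A2 D2] := step _ oN1.
have [A3 D3] := step _ i1.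
have [A4 D4] := step _ iN1.
move: A1 A2 A3 A4 D1 D2 D3 D4; rewrite !sqrrN ii expr1n !mul1r.
move: (P (z + t%:C * 1)) (P (z + t%:C * -1)) (P (z + t%:C * 'i)) (P (z + t%:C * - 'i)).
move: (P z) => p p1 p2 p3 p4.
rewrite !mulrN !mulNr !mulrN !mulr1 !mul1r !(mulrDr c) !mulrN !ReD !ReN.
rewrite !ltr_norml => A1 A2 A3 A4 /andP[D1 D1'] /andP[D2 D2'] /andP[D3 D3'] /andP[D4 D4'].
have t2 : 0 < t ^+ 2 by rewrite exprn_gt0.
(* Over the four directions [o ^+ 2] is 1, 1, -1, -1, so the terms in [Re (c * p)] cancel. The four
   errors are each below [e], so together they exceed [- 4 e t^2], against [+ 4 e t^2] from the
   quadratic term, while the sum should be at most 0. *)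
nra.
Qed.

(** If the bound fails at [z0], rotate by the conjugate of [psi z0] and add a small multiple of
    [|z - a|^2]: the maximum of the resulting real function can lie neither on the circle, nor at a
    zero of [psi], nor at a point with an expansion. Zeros of [psi] are exempt from the expansion so
    that singularities can be hidden there by a vanishing factor. *)
Lemma maximum_principle (psi : C -> C) (a : C) (r M : R) :
  0 < r -> 0 <= M ->
  (forall z, cabs (z - a) <= r -> {for z, continuous psi}) ->
  (forall z, cabs (z - a) < r -> psi z != 0 -> expansion2 psi z) ->
  (forall z, cabs (z - a) = r -> cabs (psi z) <= M) ->
  forall z, cabs (z - a) <= r -> cabs (psi z) <= M.
Proof.
move=> r0 M0 cpsi epsi bpsi z0 z0r; rewrite leNgt; apply/negP => Mz0.
pose n := cabs (psi z0).
have n0 : 0 < n by apply: le_lt_trans Mz0.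
(* With this [e] the perturbation is at most [n (n - M) / 2] on the disc, so on the circle the
   function is at most [n M + n (n - M) / 2], which is less than [n^2], a lower bound for its value
   at [z0]. *)
pose e := n * (n - M) / (2 * r ^+ 2).
have r2 : 0 < r ^+ 2 by rewrite exprn_gt0.
have e0 : 0 < e by rewrite divr_gt0 // mulr_gt0 // subr_gt0.
have er : e * r ^+ 2 = n * (n - M) / 2 by rewrite /e; field; rewrite gt_eqF.
pose c := (psi z0)^*%C.
have cn : cabs c = n.
  by apply: complexI; rewrite -!cabsE; exact: normcJ.
pose u z := complex.Re (c * psi z) + e * cabs (z - a) ^+ 2.
have cu : {within cdisc a r, continuous u}.
  apply: continuous_in_subspaceT => z; rewrite inE => /cdiscE zr.
  apply: (@continuousD R R C (fun z => complex.Re (c * psi z)) (fun z => e * cabs (z - a) ^+ 2)).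
    apply: (@continuous_comp C C R (fun z => c * psi z) (@complex.Re R)).
      by apply: (@continuous_forM R (fun=> c) psi z); [exact: cst_continuous | exact: cpsi].
    exact: continuous_complexRe.
  apply: (@continuousM R C (fun _ => e) (fun z => cabs (z - a) ^+ 2)); first exact: cst_continuous.
  apply: (@continuous_comp C R R (fun z => cabs (z - a)) (fun x => x ^+ 2)).
    apply: (@continuous_comp C C R (fun z => z - a) cabs).
      exact: continuous_subr.
    exact: continuous_cabs.
  exact: exprn_continuous.
have [|z1 /set_mem/cdiscE z1r z1max] := compact_EVT_max _ (@compact_cdisc R a r) cu.
  by exists z0; apply/cdiscE.
have {}z1max z : cabs (z - a) <= r -> u z <= u z1.
  by move=> zr; apply: z1max; apply/mem_set/cdiscE.
have z1b : e * cabs (z1 - a) ^+ 2 <= e * r ^+ 2.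
  by rewrite ler_pM2l // lerXn2r // ?nnegrE ?cabs_ge0 // ltW.
have uz0 : n ^+ 2 <= u z0.
  rewrite /u /c Re_conj_mul cabsE -rmorphXn /= lerDl mulr_ge0 //; first exact: ltW.
  by rewrite exprn_ge0 // cabs_ge0.
have uz := z1max z0 z0r.
have [z1E|z1lt] := eqVneq (cabs (z1 - a)) r.
  have : complex.Re (c * psi z1) <= n * M.
    apply: le_trans (ler_norm _) _; apply: le_trans (Re_le_cabs _) _.
    by rewrite cabsM cn ler_wpM2l ?bpsi // ltW.
  move: uz uz0 z1b; rewrite er /u; nra.
have {}z1lt : cabs (z1 - a) < r by rewrite lt_neqAle z1lt.
have [psi0|psi0] := eqVneq (psi z1) 0.
  move: uz uz0 z1b; rewrite er /u psi0 mulr0 /=; nra.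
apply: (@no_interior_max psi c a z1 e e0 (epsi _ z1lt psi0)).
apply/near_realP; exists (r - cabs (z1 - a)); first by rewrite subr_gt0.
move=> w wz; apply: z1max.
have -> : w - a = (w - z1) - (a - z1) by ring.
apply: le_trans (cabsB _ _) _.
have -> : cabs (a - z1) = cabs (z1 - a) by rewrite /cabs distrC.
by rewrite -lerBrDr ltW.
Qed.

Lemma bernoulli_le (x : R) n : 0 <= x -> 1 + n%:R * x <= (1 + x) ^+ n.
Proof.
move=> x0; elim: n => [|n IHn]; first by rewrite mul0r addr0 expr0.
rewrite exprS -natr1.
apply: le_trans (_ : _ <= (1 + x) * (1 + n%:R * x)) _.
  have := mulr_ge0 (ler0n R n) (sqr_ge0 x); nra.
by rewrite ler_pM2l // ltr_pwDl.
Qed.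

(** By Bernoulli's inequality the powers of a number above 1 are unbounded. This is what lets a
    factor independent of the exponent disappear from an estimate on powers. *)
Lemma bounded_expr_le1 (x D : R) : 0 <= x ->
  (forall n, x ^+ n.+1 <= D) -> x <= 1.
Proof.
move=> x0 xD; rewrite leNgt; apply/negP => x1.
have y0 : 0 < x - 1 by rewrite subr_gt0.
have D0 : 0 <= D by apply: le_trans (xD 0%N); rewrite exprn_ge0.
have := archi_boundP (divr_ge0 D0 (ltW y0)).
set N := Num.bound _ => HN.
have := bernoulli_le N.+1 (ltW y0); rewrite (_ : 1 + (x - 1) = x) => [H|]; last by ring.
have := le_trans H (xD N); rewrite -natr1.
move: HN; rewrite ltr_pdivrMr // => HN; nra.
Qed.

Lemma expansion2X f z n : expansion2 f z -> expansion2 (fun w => f w ^+ n) z.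
Proof.
move=> fz; elim: n => [|n IHn].
  rewrite (_ : (fun w => _) = fun=> 1); first exact: expansion2_cst.
  by apply/funext => w; rewrite expr0.
rewrite (_ : (fun w => _) = fun w => f w * f w ^+ n); first exact: expansion2M.
by apply/funext => w; rewrite exprS.
Qed.

Lemma expansion2_prod_subr (s : seq C) z :
  expansion2 (fun w => \prod_(x <- s) (w - x)) z.
Proof.
elim: s => [|x s IHs].
  rewrite (_ : (fun w => _) = fun=> 1); first exact: expansion2_cst.
  by apply/funext => w; rewrite big_nil.
rewrite (_ : (fun w => _) = fun w => (w - x) * \prod_(x <- s) (w - x)).
  by apply: expansion2M => //; apply: expansion2_subr; exact: expansion2_id.
by apply/funext => w; rewrite big_cons.
Qed.

Lemma continuous_bounded_mul0 (f g : C -> C) z (B : R) :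
  (\forall w \near z, w != z -> cabs (f w) <= B) ->
  {for z, continuous g} -> g z = 0 -> {for z, continuous (fun w => f w * g w)}.
Proof.
move=> fB cg gz0; apply/continuous_at_realP => e e0.
have B1 : 0 < Num.max B 1 by rewrite lt_max ltr01 orbT.
have eB : 0 < e / Num.max B 1 by rewrite divr_gt0.
have ge : \forall w \near z, cabs (g w - g z) < e / Num.max B 1.
  by apply/near_realP; exact: (continuous_at_realP g z).1 cg _ eB.
have [d d0 dP] := (near_realP _ _).1 (filterI fB ge).
exists d => // w /dP[fw gw]; rewrite gz0 mulr0 subr0 cabsM.
have [->|wz] := eqVneq w z; first by rewrite gz0 /cabs normr0 /= mulr0.
rewrite gz0 subr0 in gw.
apply: le_lt_trans (_ : _ <= Num.max B 1 * cabs (g w)) _.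
  by rewrite ler_wpM2r ?cabs_ge0 // le_max fw.
by rewrite mulrC -ltr_pdivlMr.
Qed.

(* The bound [M] survives the singularities because [phi ^+ n * \prod (z - s)]
   is continuous at them, and the factor [\prod (z - s)] is negligible after
   taking [n]-th roots. *)
Lemma maximum_principle_except (phi : C -> C) (S : seq C) (a : C) (r M : R) :
  0 < r -> 0 < M ->
  (forall z, cabs (z - a) <= r -> z \notin S -> expansion2 phi z) ->
  (forall s, s \in S -> cabs (s - a) < r /\
     exists B, \forall w \near s, w != s -> cabs (phi w) <= B) ->
  (forall z, cabs (z - a) = r -> cabs (phi z) <= M) ->
  forall z, cabs (z - a) <= r -> z \notin S -> cabs (phi z) <= M.
Proof.
move=> r0 M0 ephi Sphi bphi z zr zS.
pose p (w : C) := \prod_(x <- S) (w - x).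
have cp w : {for w, continuous p} by apply/expansion2_continuous/expansion2_prod_subr.
have p0 w : (p w == 0) = (w \in S).
  apply/idP/idP; rewrite /p.
    elim: S {ephi Sphi zS p cp} => [|x S IHS]; first by rewrite big_nil oner_eq0.
    by rewrite big_cons mulf_eq0 subr_eq0 inE => /orP[->//|/IHS ->]; rewrite orbT.
  by move=> wS; rewrite (big_rem w) //= subrr mul0r.
have pb w : cabs (w - a) = r -> cabs (p w) <= (2 * r) ^+ size S.
  move=> wr; rewrite /p; elim: S Sphi {ephi zS p cp p0} => [|x S IHS] Sphi.
    by rewrite big_nil expr0 -[1]/(1%:C) cabs_real normr1.
  rewrite big_cons cabsM exprS ler_pM ?cabs_ge0 //.
    have [xr _] := Sphi x (mem_head _ _).
    rewrite (_ : w - x = (w - a) - (x - a)); last by ring.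
    by apply: le_trans (cabsB _ _) _; rewrite wr mulrDl mul1r lerD2l ltW.
  by apply: IHS => y yS; apply: Sphi; rewrite inE yS orbT.
have pz0 : 0 < cabs (p z) by rewrite lt_neqAle cabs_ge0 eq_sym cabs_eq0 p0 zS.
have r20 : 0 <= (2 * r) ^+ size S by rewrite exprn_ge0 // mulr_ge0 // ltW.
(* It suffices to bound all powers of [cabs (phi z) / M] by one constant. On the circle [p] is at
   most [(2 * r) ^+ size S], so the maximum principle for [phi ^+ n.+1 * p] gives the constant
   [(2 * r) ^+ size S / cabs (p z)]. *)
rewrite -[M]mul1r -ler_pdivrMr //.
apply: (@bounded_expr_le1 _ ((2 * r) ^+ size S / cabs (p z))).
  by rewrite divr_ge0 ?cabs_ge0 // ltW.
move=> n; rewrite expr_div_n ler_pdivlMr // mulrAC ler_pdivrMr ?exprn_gt0 //.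
rewrite -cabsX -cabsM [leRHS]mulrC.
have epsi w : cabs (w - a) <= r -> w \notin S ->
    expansion2 (fun w => phi w ^+ n.+1 * p w) w.
  move=> wr wS; apply: expansion2M; last exact: expansion2_prod_subr.
  by apply: expansion2X; exact: ephi.
have MS0 : 0 <= M ^+ n.+1 * (2 * r) ^+ size S by rewrite mulr_ge0 // exprn_ge0 // ltW.
apply: (@maximum_principle (fun w => phi w ^+ n.+1 * p w) a r _ r0 MS0 _ _ _ z zr).
- move=> w wr; have [wS|wS] := boolP (w \in S); last first.
    by apply: expansion2_continuous; exact: epsi.
  have [_ [B wB]] := Sphi w wS.
  apply: (@continuous_bounded_mul0 _ _ _ (B ^+ n.+1)).
  + have [d d0 dP] := (near_realP _ _).1 wB.
    apply/near_realP; exists d => // v /dP vB vw; rewrite cabsX.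
    have Bv := vB vw.
    by rewrite lerXn2r // ?nnegrE ?cabs_ge0 //; apply: le_trans Bv; exact: cabs_ge0.
  + exact: cp.
  + by apply/eqP; rewrite p0.
- move=> w wr; rewrite mulf_eq0 negb_or p0 => /andP[_ wS].
  by apply: epsi => //; exact: ltW.
- move=> w wr; rewrite cabsM cabsX ler_pM ?exprn_ge0 ?cabs_ge0 //; last exact: pb.
  by rewrite lerXn2r // ?nnegrE ?cabs_ge0 ?bphi // ltW.
Qed.

End MaximumPrinciple.

(** * Divided differences and smoothness *)

Section DividedDifferences.
Variable F : fieldType.
Implicit Types (f : F -> F) (s t : seq F).

(** The divided difference [f[x_1, ..., x_k]] in Lagrange's symmetric form, which makes it visibly
    independent of the order of the nodes. It has this meaning only for distinct nodes, hence the
    [uniq] hypotheses below. *)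
Definition divdiff f s :=
  \sum_(x <- s) f x / \prod_(y <- s | y != x) (x - y).

Lemma perm_divdiff f s t : perm_eq s t -> divdiff f s = divdiff f t.
Proof.
move=> st; rewrite /divdiff (perm_big _ st); apply: eq_bigr => x _.
by rewrite (perm_big _ st).
Qed.

Lemma divdiff1 f x : divdiff f [:: x] = f x.
Proof. by rewrite /divdiff big_seq1 big_cons eqxx big_nil divr1. Qed.

Lemma divdiff_cons f x s : x \notin s ->
  divdiff f (x :: s) = f x / \prod_(y <- s) (x - y) +
    \sum_(z <- s) f z / ((z - x) * \prod_(y <- s | y != z) (z - y)).
Proof.
move=> xs; rewrite /divdiff big_cons big_cons eqxx /=; congr (_ / _ + _).
  rewrite big_seq_cond [RHS]big_seq; apply: eq_bigl => y.
  by case: (boolP (y \in s)) => //= ys; apply: contraNneq xs => <-.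
apply: eq_big_seq => z zs; rewrite big_cons ifT //.
by apply: contraNneq xs => ->.
Qed.

Lemma divdiff_rec f x y s : uniq [:: x, y & s] ->
  divdiff f [:: x, y & s] * (x - y) = divdiff f (x :: s) - divdiff f (y :: s).
Proof.
rewrite /= inE negb_or => /andP[/andP[xy xs] /andP[ys us]].
have xy0 : x - y != 0 by rewrite subr_eq0.
have yx0 : y - x != 0 by rewrite subr_eq0 eq_sym.
rewrite divdiff_cons ?inE ?negb_or ?xy // (divdiff_cons f xs) (divdiff_cons f ys).
rewrite !big_cons eqxx /= opprD addrACA -sumrB mulrDl -addrA; congr (_ + _).
  by rewrite invfM; move: (\prod_(_ <- _) _)^-1 => b; field.
rewrite mulrDl mulr_suml; congr (_ + _).
  rewrite (_ : \prod_(j <- s | j != y) (y - j) = \prod_(j <- s) (y - j)).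
    by rewrite invfM; move: (\prod_(_ <- _) _)^-1 => b; field; rewrite yx0.
  rewrite big_seq_cond [RHS]big_seq; apply: eq_bigl => z.
  by case: (boolP (z \in s)) => //= zs; apply: contraNneq ys => <-.
apply: eq_big_seq => z zs.
have zx : z - x != 0 by rewrite subr_eq0; apply: contraNneq xs => <-.
have zy : z - y != 0 by rewrite subr_eq0; apply: contraNneq ys => <-.
rewrite big_cons ifT; last by rewrite -subr_eq0 -opprB oppr_eq0.
rewrite !invfM; move: (\prod_(_ <- _ | _) _)^-1 => b; field.
by rewrite zx zy.
Qed.

End DividedDifferences.

Section DividedDifferenceBounds.
Variable R : realType.
Local Notation C := (cplx R).
Implicit Types (f g : C -> C) (z : C) (s t : seq C).

Lemma near_all (P : C -> C -> Prop) s z :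
  (forall x, x \in s -> \forall w \near z, P x w) ->
  \forall w \near z, forall x, x \in s -> P x w.
Proof.
elim: s => [_|y s IHs Ps]; first by apply/nearP; exists 1.
have H1 := Ps y (mem_head _ _).
have H2 : \forall w \near z, forall x, x \in s -> P x w.
  by apply: IHs => x xs; apply: Ps; rewrite inE xs orbT.
have [d d0 dP] := (nearP _ _).1 (filterI H1 H2).
apply/nearP; exists d => // w /dP[Py Pw] x.
by rewrite inE => /orP[/eqP ->|/Pw].
Qed.

Lemma near_notin s z : z \notin s -> \forall w \near z, w \notin s.
Proof.
move=> zs; have H : \forall w \near z, forall x, x \in s -> w != x.
  apply: near_all => x xs; apply: near_neq.
  by apply: contraNneq zs => ->.
have [d d0 dP] := (nearP _ _).1 H.
apply/nearP; exists d => // w /dP wP; apply/negP => /wP.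
by rewrite eqxx.
Qed.

Lemma divdiff_consE f w y s : uniq (y :: s) -> w \notin y :: s ->
  divdiff f [:: w, y & s] = (divdiff f (w :: s) - divdiff f (y :: s)) / (w - y).
Proof.
move=> uys wys; rewrite -divdiff_rec; last by rewrite cons_uniq wys.
by rewrite mulfK // subr_eq0; apply: contraNneq wys => ->; rewrite mem_head.
Qed.

Lemma expansion2_divdiff f s z : expansion2 f z -> uniq s -> z \notin s ->
  expansion2 (fun w => divdiff f (w :: s)) z.
Proof.
move=> fz; elim: s => [_ _|y s IHs uys zys].
  rewrite (_ : (fun w => _) = f) //.
  by apply/funext => w; rewrite divdiff1.
have [ys us] := andP uys.
have zs : z \notin s by move: zys; rewrite inE negb_or => /andP[].
have zy : z != y by move: zys; rewrite inE negb_or => /andP[].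
apply: (@expansion2_near_eq _ (fun w => (divdiff f (w :: s) - divdiff f (y :: s)) * (w - y)^-1)).
  apply: expansion2M; last exact: expansion2_inv.
  by apply: expansion2_subr; exact: IHs.
have [d d0 dP] := (nearP _ _).1 (near_notin zys).
by apply/nearP; exists d => // w /dP wP; rewrite divdiff_consE.
Qed.

(** Moving the node [y] next to [w] exhibits [f[w, s]] as the difference quotient at [y] of [w |->
    f[w, rem y s]]. That function has an expansion at [y], so its quotients are bounded. *)
Lemma divdiff_near_bounded f s y : expansion2 f y -> uniq s -> y \in s ->
  exists B : R, \forall w \near y, w != y -> cabs (divdiff f (w :: s)) <= B.
Proof.
move=> fy us ys; have ps := perm_to_rem ys.
have uys : uniq (y :: rem y s) by rewrite -(perm_uniq ps).
have ny : y \notin rem y s by case/andP: uys.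
have urem : uniq (rem y s) by case/andP: uys.
have [B0 HB] := slope_bounded (expansion2_divdiff fy urem ny).
exists (complex.Re B0).
have [d d0 dP] := (nearP _ _).1 (filterI HB (near_notin ny)).
apply/nearP; exists d => // w /dP[wB wn] wy.
rewrite (@perm_divdiff _ f _ [:: w, y & rem y s]); last by rewrite perm_cons.
rewrite divdiff_consE //; last by rewrite inE negb_or wy.
by have := wB wy; rewrite lecE => /andP[_].
Qed.

Lemma bounded_on_cdisc f a r :
  (forall z, cabs (z - a) <= r -> {for z, continuous f}) ->
  exists B : R, forall z, cabs (z - a) <= r -> cabs (f z) <= B.
Proof.
move=> cf; have [r0|r0] := leP 0 r; last first.
  by exists 0 => z /(le_trans (cabs_ge0 _)); rewrite leNgt r0.
pose u z := cabs (f z).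
have cu : {within cdisc a r, continuous u}.
  apply: continuous_in_subspaceT => z; rewrite inE => /cdiscE zr.
  apply: (@continuous_comp C C R f (@cabs R)); first exact: cf.
  exact: continuous_cabs.
have [|z1 _ zmax] := compact_EVT_max _ (@compact_cdisc R a r) cu.
  by exists a; apply/cdiscE; rewrite subrr /cabs normr0.
by exists (u z1) => z zr; apply: zmax; apply/mem_set/cdiscE.
Qed.

(* On the circle [|w - a| = r] the recurrence bounds the next divided difference;
   the maximum principle carries the bound inside. *)
Lemma divdiff_bounded f a r k : 0 < r ->
  (forall z, cabs (z - a) <= r -> expansion2 f z) ->
  exists B : R, forall s, uniq s -> size s = k ->
    (forall x, x \in s -> cabs (x - a) <= r / 2) ->
    forall w, cabs (w - a) <= r -> w \notin s -> cabs (divdiff f (w :: s)) <= B.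
Proof.
move=> r0 ef.
have hr : r / 2 < r by rewrite ltr_pdivrMr // ltr_pMr // ltr1n.
have hr0 : 0 < r / 2 by rewrite divr_gt0.
elim: k => [|k [B HB]].
  have [B HB] : exists B : R, forall z, cabs (z - a) <= r -> cabs (f z) <= B.
    by apply: bounded_on_cdisc => z zr; apply: expansion2_continuous; exact: ef.
  by exists B => s _ /size0nil -> _ w wr _; rewrite divdiff1; exact: HB.
exists ((`|B| + `|B|) / (r / 2) + 1) => s us sk sr.
have M0 : 0 < (`|B| + `|B|) / (r / 2) + 1.
  by rewrite ltr_wpDl // divr_ge0 ?addr_ge0 // ltW.
apply: (@maximum_principle_except R (fun w => divdiff f (w :: s)) s a r _ r0 M0).
- by move=> z zr zs; apply: expansion2_divdiff => //; exact: ef.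
- move=> x xs; split; first by apply: le_lt_trans hr; exact: sr.
  apply: divdiff_near_bounded => //; apply: ef.
  by apply: le_trans (ltW hr); exact: sr.
- move=> z zr; case: s us sk sr => // y s uys [sk] sr.
  have zys : z \notin y :: s.
    by apply/negP => /sr; rewrite zr leNgt hr.
  have zs : z \notin s by move: zys; rewrite inE negb_or => /andP[].
  have [ys us] := andP uys.
  have {}sr' x : x \in s -> cabs (x - a) <= r / 2.
    by move=> xs; apply: sr; rewrite inE xs orbT.
  rewrite divdiff_consE // -[_ / _]divr1.
  have zy : r / 2 <= cabs (z - y).
    have : cabs ((z - y) - (a - y)) <= cabs (z - y) + cabs (a - y) := cabsB _ _.
    have -> : z - y - (a - y) = z - a by ring.
    have -> : cabs (a - y) = cabs (y - a) by rewrite /cabs distrC.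
    have := sr y (mem_head _ _); rewrite zr; lra.
  have zy0 : 0 < cabs (z - y) by apply: lt_le_trans zy.
  rewrite divr1 -(ler_pM2r zy0) -cabsM divfK; last by rewrite -cabs_eq0 gt_eqF.
  have H1 : cabs (divdiff f (z :: s)) <= `|B|.
    by apply: le_trans (ler_norm B); apply: HB => //; rewrite zr.
  have H2 : cabs (divdiff f (y :: s)) <= `|B|.
    apply: le_trans (ler_norm B); apply: HB => //.
    by apply: le_trans (ltW hr); apply: sr; exact: mem_head.
  apply: le_trans (cabsB _ _) _; apply: le_trans (lerD H1 H2) _.
  have E : (`|B| + `|B|) = (`|B| + `|B|) / (r / 2) * (r / 2) by rewrite divfK // gt_eqF.
  rewrite {1}E; apply: ler_pM => //; first by rewrite divr_ge0 ?addr_ge0 // ltW.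
    exact: ltW.
  by rewrite lerDl.
Qed.

End DividedDifferenceBounds.

(** * From bounded divided differences to derivatives of all orders *)

Section Smoothness.
Variable R : realType.
Local Notation C := (cplx R).
Implicit Types (f g : C -> C) (z : C) (s t : seq C).

Lemma cabsD (z w : C) : cabs (z + w) <= cabs z + cabs w.
Proof. by rewrite -lecR rmorphD -!cabsE ler_normD. Qed.

Lemma cabs0 : cabs (0 : C) = 0.
Proof. by apply/eqP; rewrite cabs_eq0. Qed.

(** The bound may depend on the number of nodes but not on their position. This uniformity is what
    survives letting nodes merge, and hence passing to the derivative. *)
Definition bounded_divdiff f (a : C) (rho : R) := forall k,
  exists B : R, forall s, uniq s -> size s = k.+1 ->
    (forall x, x \in s -> cabs (x - a) < rho) -> cabs (divdiff f s) <= B.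

(* The shifts are performed one point at a time; each of them costs a divided
   difference with one more point. *)
Lemma divdiff_shift f (a : C) (rho B : R) (h : C) s t :
  (forall u, uniq u -> size u = (size s + size t).+1 ->
    (forall x, x \in u -> cabs (x - a) < rho) -> cabs (divdiff f u) <= B) ->
  uniq (s ++ t ++ map (+%R^~ h) t) ->
  (forall x, x \in s ++ t ++ map (+%R^~ h) t -> cabs (x - a) < rho) ->
  cabs (divdiff f (s ++ map (+%R^~ h) t) - divdiff f (s ++ t)) <=
    (size t)%:R * (B * cabs h).
Proof.
elim: t s => [|x t IHt] s HB us hs; first by rewrite subrr mul0r cabs0.
rewrite /= in us hs *; set t' := map _ t in us hs *.
have pst : perm_eq (s ++ (x :: t) ++ ((x + h) :: t')) [:: x + h, x & s ++ t ++ t'].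
  by apply/permP => p; rewrite /= !count_cat /= !count_cat /=; lia.
have p1 : perm_eq (s ++ (x + h) :: t') (x + h :: s ++ t').
  by apply/permP => p; rewrite /= !count_cat /=; lia.
have p2 : perm_eq (s ++ x :: t) ((x :: s) ++ t).
  by apply/permP => p; rewrite /= !count_cat /=; lia.
have us2 : uniq [:: x + h, x & s ++ t ++ t'] by rewrite -(perm_uniq pst).
have sub3 : subseq [:: x + h, x & s ++ t'] [:: x + h, x & s ++ t ++ t'].
  by rewrite /= !eqxx; apply: cat_subseq => //; exact: suffix_subseq.
have us3 := subseq_uniq sub3 us2.
have hs2 y : y \in [:: x + h, x & s ++ t ++ t'] -> cabs (y - a) < rho.
  by rewrite -(perm_mem pst); exact: hs.
rewrite (perm_divdiff f p1) (perm_divdiff f p2).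
(* Intermediate term: [x] unshifted, the nodes of [t] shifted. The induction hypothesis, with [x]
   moved into the fixed part, covers one difference; the recurrence turns the other into [h] times a
   divided difference on [x + h], [x], [s] and [t']. *)
rewrite -(subrKA (divdiff f (x :: s ++ t'))) -divdiff_rec // -natr1 mulrDl mul1r addrC.
apply: le_trans (cabsD _ _) _; apply: lerD.
  apply: (IHt (x :: s)) => [u uu su||y ys4].
  - by apply: HB => //; rewrite su /= addSn addnS.
  - exact: subseq_uniq (subseq_cons _ _) us2.
  - by apply: hs2; rewrite inE ys4 orbT.
rewrite addrAC subrr add0r cabsM ler_wpM2r ?cabs_ge0 //.
apply: HB => //; first by rewrite /= size_cat size_map addnS.
by move=> y /(mem_subseq sub3)/hs2.
Qed.

Lemma bounded_slope_limit (G : C -> C) (z l : C) (K : R) : is_derive z 1 G l ->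
  (\forall w \near z, w != z -> cabs (G w - G z) <= K * cabs (w - z)) ->
  cabs l <= K.
Proof.
move=> /is_derive_slopeM[P [cP <- GP]] GK; rewrite leNgt; apply/negP => KP.
have e0 : 0 < cabs (P z) - K by rewrite subr_gt0.
have Pe : \forall w \near z, cabs (P w - P z) < cabs (P z) - K.
  by apply/near_realP; exact: (continuous_at_realP P z).1 cP _ e0.
have [d d0 dP] := (near_realP _ _).1 (filterI Pe GK).
have d2 : 0 < d / 2 by rewrite divr_gt0.
have wz : z + (d / 2)%:C - z = (d / 2)%:C by rewrite addrAC subrr add0r.
have [|] := dP (z + (d / 2)%:C).
  by rewrite wz cabs_real gtr0_norm // ltr_pdivrMr // ltr_pMr // ltr1n.
have nz : z + (d / 2)%:C != z.
  by rewrite -subr_eq0 wz -cabs_eq0 cabs_real gtr0_norm // gt_eqF.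
move=> Pw /(_ nz); rewrite GP wz (addrC (G z)) addrK cabsM cabs_real gtr0_norm //.
rewrite mulrC ler_pM2r //; move: Pw; move: (P (z + _)) => p Pw pK.
have := cabsB p (p - P z); rewrite (_ : p - (p - P z) = P z); last by ring.
lra.
Qed.

(** Used with the Lagrange weights for [c]: a common translation of all nodes leaves the weights
    alone, so [f'[s]] is the derivative at [h = 0] of [f[s + h]]. *)
Lemma is_derive_shift_sum f (c : C -> C) s :
  (forall x, x \in s -> derivable f x 1) ->
  is_derive (0 : C) (1 : C) (fun h : C => \sum_(x <- s) f (x + h) * c x)
    (\sum_(x <- s) derive1 f x * c x).
Proof.
move=> fs; suff [P [cP P0 HP]] : exists P : C -> C, [/\ {for 0, continuous P},
    P 0 = \sum_(x <- s) derive1 f x * c x &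
    forall h, \sum_(x <- s) f (x + h) * c x =
      \sum_(x <- s) f (x + 0) * c x + (h - 0) * P h].
  by rewrite -P0; exact: slope_is_deriveM.
elim: s fs => [|x s IHs] fs.
  exists (fun=> 0); split; rewrite ?big_nil //; first exact: cst_continuous.
  by move=> h; rewrite !big_nil mulr0 addr0.
have [|P [cP P0 HP]] := IHs; first by move=> y ys; apply: fs; rewrite inE ys orbT.
have /derivable_is_derive1/is_derive_slopeM[Q [cQ Qx fQ]] := fs x (mem_head _ _).
exists (fun h => Q (x + h) * c x + P h); split.
- have cx : {for (0 : C), continuous (fun h : C => x + h)}.
    by apply: (@continuous_forD R (fun=> x) id); [exact: cst_continuous | exact: cvg_id].
  have cQx : {for (0 : C), continuous (fun h : C => Q (x + h))}.
    by apply: (@continuous_comp C C C (fun h => x + h) Q); [exact: cx | rewrite addr0; exact: cQ].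
  apply: (@continuous_forD R (fun h => Q (x + h) * c x) P 0); last exact: cP.
  apply: (@continuous_forM R (fun h => Q (x + h)) (fun=> c x) 0); first exact: cQx.
  exact: cst_continuous.
- by rewrite big_cons addr0 Qx P0.
- by move=> h; rewrite !big_cons HP (fQ (x + h)) addr0; ring.
Qed.

Lemma divdiff_map_shift f s h :
  divdiff f (map (+%R^~ h) s) =
  \sum_(x <- s) f (x + h) * (\prod_(y <- s | y != x) (x - y))^-1.
Proof.
rewrite /divdiff big_map; apply: eq_bigr => x _; congr (_ / _).
rewrite big_map; apply: eq_big => y; first by rewrite (inj_eq (addIr h)).
by move=> _; rewrite opprD addrACA subrr addr0.
Qed.

(** The divided difference of [derive1 f] is the derivative in [h] of the one of [f] on translated
    nodes. Its increments are at most [k.+1 * B * |h|], where [B] bounds the divided differences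
    with one node more. *)
Lemma bounded_divdiff_derive1 f a rho :
  (forall z, cabs (z - a) < rho -> derivable f z 1) ->
  bounded_divdiff f a rho -> bounded_divdiff (derive1 f) a rho.
Proof.
move=> fd bf k; have [B HB] := bf k.+1; exists ((k.+1)%:R * B) => s us sk hs.
have dG := @is_derive_shift_sum f (fun x => (\prod_(y <- s | y != x) (x - y))^-1) s
  (fun x xs => fd x (hs x xs)).
apply: (bounded_slope_limit dG).
have near_in : \forall h \near 0, forall x, x \in s -> cabs (x + h - a) < rho.
  apply: near_all => x xs; apply/near_realP.
  exists (rho - cabs (x - a)); first by rewrite subr_gt0 hs.
  move=> h; rewrite subr0 ltrBrDr => H; apply: le_lt_trans H.
  by rewrite addrAC addrC; exact: cabsD.
(* For small nonzero [h] no translated node meets an old one, so the nodes used in the shift are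
   distinct. *)
have near_ne : \forall h \near 0, forall x, x \in s -> forall y, y \in s ->
    h != 0 -> x + h != y.
  apply: near_all => x xs; apply: near_all => y ys.
  have [->|xy] := eqVneq x y.
    apply/nearP; exists 1 => // h _ h0.
    by rewrite -[X in _ != X]addr0 (inj_eq (addrI y)).
  have [|d d0 dP] := (nearP _ _).1 (@near_neq R 0 (y - x) _).
    by rewrite eq_sym subr_eq0 eq_sym.
  by apply/nearP; exists d => // h /dP H _; apply: contraNneq H => <-; rewrite addrAC subrr add0r.
have [d d0 dP] := (nearP _ _).1 (filterI near_in near_ne).
apply/nearP; exists d => // h /dP[hin hne] h0.
rewrite -!divdiff_map_shift subr0.
rewrite (_ : map (+%R^~ 0) s = s); last first.
  by rewrite -[RHS]map_id; apply: eq_map => x; rewrite addr0.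
rewrite -sk -mulrA; apply: (@divdiff_shift f a rho B h [::] s).
- by move=> u uu su; apply: HB => //; rewrite su /= add0n sk.
- rewrite /= cat_uniq us (map_inj_uniq (addIr h)) us andbT /=.
  by apply/hasPn => _ /mapP[x xs ->]; apply/negP => /(hne x xs) /(_ h0); rewrite eqxx.
- by move=> y; rewrite /= mem_cat => /orP[/hs //|/mapP[x xs ->]]; exact: hin.
Qed.

Lemma compact_cluster_slope (q : C -> C) (z : C) (M : R) :
  (\forall w \near z, w != z -> cabs (q w) <= M) ->
  exists l : C, forall e : R, 0 < e -> forall d : R, 0 < d ->
    exists w, [/\ w != z, cabs (w - z) < d & cabs (q w - l) < e].
Proof.
move=> qM; have FK : (q @ z^') (cdisc 0 M).
  have [d d0 dP] := (nearP _ _).1 qM.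
  apply/nbhs_ballP; exists d => // w; rewrite -ball_normE /= distrC => wd wz.
  by apply/cdiscE; rewrite subr0; exact: dP.
have [l [_ cl]] := @compact_cdisc R 0 M (q @ z^') _ FK.
exists l => e e0 d d0.
pose A := q @` [set w | w != z /\ cabs (w - z) < d].
have qA : (q @ z^') A.
  apply/nbhs_ballP; exists d%:C => [|w]; first by rewrite /= ltcR.
  rewrite -ball_normE /= distrC cabsE ltcR => wd wz.
  by exists w.
have lB : nbhs l [set v | cabs (v - l) < e] by apply/near_realP; exists e.
by have [_ [[w [wz wd] <-] we]] := cl _ _ qA lB; exists w.
Qed.

(** The quotient [q w = f[w, z]] satisfies [q w - q w' = f[w, w', z] * (w - w')], so a bound on
    three nodes makes it Lipschitz. It is then bounded, has a cluster value at [z] by compactness,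
    and converges to it. *)
Lemma bounded_divdiff_derivable f a rho z :
  bounded_divdiff f a rho -> cabs (z - a) < rho -> derivable f z 1.
Proof.
move=> bf za; have [B HB] := bf 2.
pose q w := (f w - f z) / (w - z).
have near_in : \forall w \near z, cabs (w - a) < rho.
  apply/near_realP; exists (rho - cabs (z - a)); first by rewrite subr_gt0.
  move=> w; rewrite ltrBrDr => H; apply: le_lt_trans H.
  by apply: le_trans (cabsD _ _); rewrite subrKA.
have [d0 d00 near_in'] := (near_realP _ _).1 near_in.
have qlip w w' : cabs (w - z) < d0 -> cabs (w' - z) < d0 -> w != z -> w' != z ->
    cabs (q w - q w') <= `|B| * cabs (w - w').
  move=> /near_in' wa /near_in' wa' wz wz'.
  have [->|ww'] := eqVneq w w'; first by rewrite !subrr cabs0 mulr0.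
  have qE v : v != z -> q v = divdiff f [:: v; z].
    by move=> vz; rewrite divdiff_consE ?inE //= !divdiff1.
  have u3 : uniq [:: w; w'; z] by rewrite /= !inE negb_or ww' wz wz'.
  rewrite !qE // -divdiff_rec // cabsM ler_wpM2r ?cabs_ge0 //.
  apply: le_trans (ler_norm B); apply: HB => // x.
  by rewrite !inE => /or3P[] /eqP ->.
(* A reference point other than [z]: the Lipschitz estimate between [w] and [w0] bounds [q] near
   [z]. *)
pose w0 := z + (d0 / 2)%:C.
have w0z : w0 - z = (d0 / 2)%:C by rewrite /w0 addrAC subrr add0r.
have d02 : 0 < d0 / 2 by rewrite divr_gt0.
have w0d : cabs (w0 - z) < d0.
  by rewrite w0z cabs_real gtr0_norm // ltr_pdivrMr // ltr_pMr // ltr1n.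
have w0n : w0 != z by rewrite -subr_eq0 w0z -cabs_eq0 cabs_real gtr0_norm // gt_eqF.
have qM : \forall w \near z, w != z -> cabs (q w) <= cabs (q w0) + `|B| * (d0 + d0).
  apply/near_realP; exists d0 => // w wd wz.
  have := cabsD (q w0) (q w - q w0); rewrite addrC subrK => H.
  apply: le_trans H _; rewrite lerD2l; apply: le_trans (qlip _ _ wd w0d wz w0n) _.
  rewrite ler_wpM2l //; have := cabsB (w - z) (w0 - z).
  by rewrite (_ : w - z - (w0 - z) = w - w0); [lra | ring].
have [l lP] := compact_cluster_slope qM.
pose P w := if w == z then l else q w.
suff [] : is_derive z 1 f (P z) by [].
apply: slope_is_deriveM => [|w]; last first.
  rewrite /P /q; case: eqVneq => [->|wz]; first by rewrite subrr mul0r addr0.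
  by field; rewrite subr_eq0.
apply/continuous_at_realP => e e0; rewrite /P eqxx.
have e2 : 0 < e / 2 by rewrite divr_gt0.
have B1 : 0 < `|B| + 1 by rewrite ltr_wpDl.
pose d := Num.min d0 (e / 4 / (`|B| + 1)).
have d1 : 0 < d by rewrite lt_min d00 !divr_gt0.
exists d => // w; case: eqVneq => [_ _|wz wd]; first by rewrite subrr cabs0.
have [w' [wz' wd' wl]] := lP _ e2 _ d1.
move: (wd) (wd'); rewrite !lt_min => /andP[wd1 wd2] /andP[wd1' wd2'].
have -> : q w - l = (q w - q w') + (q w' - l) by ring.
apply: le_lt_trans (cabsD _ _) _.
have H1 := qlip _ _ wd1 wd1' wz wz'.
have H2 : cabs (w - w') <= cabs (w - z) + cabs (w' - z).
  by have := cabsB (w - z) (w' - z); rewrite (_ : w - z - (w' - z) = w - w') //; ring.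
have H3 : `|B| * cabs (w - w') <= e / 2.
  apply: (@le_trans _ _ ((`|B| + 1) * (e / 4 / (`|B| + 1) + e / 4 / (`|B| + 1)))).
    rewrite ler_pM ?cabs_ge0 ?lerDl //; lra.
  by rewrite le_eqVlt; apply/orP; left; apply/eqP; field; rewrite gt_eqF.
lra.
Qed.

Lemma bounded_divdiff_derive1n f a rho n : bounded_divdiff f a rho ->
  bounded_divdiff (derive1n n f) a rho.
Proof.
move=> bf; elim: n => [|n IHn]; first exact: bf.
rewrite derive1nS.
apply: bounded_divdiff_derive1 => // z za.
exact: bounded_divdiff_derivable za.
Qed.

(** Nodes confined to the half disc satisfy the hypotheses of [divdiff_bounded] for every number of
    nodes, and boundedness of all orders reproduces itself under derivation. *)
Lemma expansion2_derivable_derive1n f (a : C) (r : R) : 0 < r ->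
  (forall z, cabs (z - a) <= r -> expansion2 f z) ->
  forall n, derivable (derive1n n f) a 1.
Proof.
move=> r0 ef n; apply: (@bounded_divdiff_derivable _ a (r / 2)).
  apply: bounded_divdiff_derive1n => k.
  have [B HB] := @divdiff_bounded R f a r k r0 ef; exists B => -[//|w s] /andP[ws us] [sk] hs.
  apply: HB => // [x xs|].
    by apply: ltW; apply: hs; rewrite inE xs orbT.
  apply: le_trans (ltW (hs w (mem_head _ _))) _.
  by rewrite ler_pdivrMr // ler_pMr // ler1n.
by rewrite subrr cabs0 divr_gt0.
Qed.

End Smoothness.

(* Calculus of functions derivable finitely often on an open set *)
Local Close Scope complex_scope.

Definition derivable_upto (K : numFieldType) (V : normedModType K) (U : set K)
  (n : nat) (f : K -> V) := forall k, (k < n)%N -> forall z, U z -> derivable (derive1n k f) z 1.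

Section DerivableUpto.
Variables (K : numFieldType) (V : normedModType K) (U : set K).
Hypothesis oU : open U.
Implicit Types (f g : K -> V) (mu : K -> K) (z : K).

Lemma near_open z : U z -> \forall w \near z, U w.
Proof. by move=> Uz; exact: open_nbhs_nbhs. Qed.

Lemma derivable_upto0 f : derivable_upto U 0 f.
Proof. by []. Qed.

Lemma derivable_uptoS n f : derivable_upto U n.+1 f <->
  (forall z, U z -> derivable f z 1) /\ derivable_upto U n (derive1 f).
Proof.
split=> [H|[H0 HS] [_|k kn] z Uz].
- split=> [z Uz|k kn z Uz]; first exact: (H 0%N).
  by rewrite -derive1Sn; exact: H.
- exact: H0.
- by rewrite derive1Sn; exact: HS.
Qed.

Lemma derivable_upto_leq m n f : (m <= n)%N ->
  derivable_upto U n f -> derivable_upto U m f.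
Proof. by move=> mn H k km; apply: H; exact: leq_trans mn. Qed.

Lemma eq_derive1n f g : (forall z, U z -> f z = g z) ->
  forall n z, U z -> derive1n n f z = derive1n n g z.
Proof.
move=> fg; elim=> [|n IHn] z Uz; first exact: fg.
rewrite !derive1nS !derive1E; apply: near_eq_derive.
by apply: filterS (near_open Uz) => w; exact: IHn.
Qed.

Lemma eq_derivable_upto n f g : (forall z, U z -> f z = g z) ->
  derivable_upto U n f -> derivable_upto U n g.
Proof.
move=> fg H k kn z Uz; apply: (near_eq_derivable _ (H k kn z Uz)).
by apply: filterS (near_open Uz) => w; exact: eq_derive1n.
Qed.

Lemma is_derive_add f g z df dg : is_derive z 1 f df -> is_derive z 1 g dg ->
  is_derive z 1 (fun w => f w + g w) (df + dg).
Proof. by move=> Hf Hg; exact: is_deriveD. Qed.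

Lemma is_derive_scale mu f z dmu df : is_derive z 1 mu dmu -> is_derive z 1 f df ->
  is_derive z 1 (fun w => mu w *: f w) (dmu *: f z + mu z *: df).
Proof.
move=> /is_derive_slope[P [cP <- muP]] /is_derive_slope[Q [cQ <- fQ]].
pose S w := P w *: f z + mu z *: Q w + (w - z) *: (P w *: Q w).
have -> : P z *: f z + mu z *: Q z = S z by rewrite /S subrr scale0r addr0.
apply: forall_slope_is_derive => [|w].
  have cz : {for z, continuous (fun w : K => w - z)}.
    by apply: continuousB; [exact: cvg_id | exact: cst_continuous].
  have cPQ : {for z, continuous (fun w => P w *: Q w)} by exact: continuousZ cP cQ.
  have c1 : {for z, continuous (fun w => P w *: f z)}.
    by apply: (@continuousZ K V K P (fun=> f z)); [exact: cP | exact: cst_continuous].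
  have c2 : {for z, continuous (fun w => mu z *: Q w)}.
    by apply: (@continuousZ K V K (fun=> mu z) Q); [exact: cst_continuous | exact: cQ].
  apply: (@continuousD K V K (fun w => P w *: f z + mu z *: Q w) (fun w => (w - z) *: (P w *: Q w))).
    exact: continuousD c1 c2.
  exact: continuousZ cz cPQ.
rewrite (muP w) (fQ w) [_ *: P w]/(_ * _).
rewrite /S scalerDl !scalerDr !scalerA -!addrA; congr (_ + _).
by rewrite addrCA (mulrC (mu z)) -!mulrA; congr (_ + (_ + _)); congr (_ *: _); ring.
Qed.

Lemma derivable_uptoD n f g : derivable_upto U n f -> derivable_upto U n g ->
  derivable_upto U n (fun w => f w + g w).
Proof.
elim: n f g => [|n IHn] f g; first by [].
move=> /derivable_uptoS[f0 fS] /derivable_uptoS[g0 gS]; apply/derivable_uptoS.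
have d z : U z -> is_derive z 1 (fun w => f w + g w) (derive1 f z + derive1 g z).
  by move=> Uz; apply: is_derive_add; apply: derivable_is_derive1; [exact: f0|exact: g0].
split=> [z /d[]//|].
apply: (eq_derivable_upto (f := fun w => derive1 f w + derive1 g w)); last exact: IHn.
by move=> z /d/is_derive1E.
Qed.

Lemma derivable_upto_cst n (c : V) : derivable_upto U n (fun=> c).
Proof.
elim: n c => [//|n IHn] c; apply/derivable_uptoS; split=> [z _|].
  exact: derivable_cst.
rewrite (_ : derive1 _ = fun=> 0); first exact: IHn.
by apply/funext => z; rewrite derive1_cst.
Qed.

Lemma derive1n_add f g n : derivable_upto U n f -> derivable_upto U n g ->
  forall z, U z -> derive1n n (fun w => f w + g w) z = derive1n n f z + derive1n n g z.
Proof.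
elim: n f g => [//|n IHn] f g /derivable_uptoS[f0 fS] /derivable_uptoS[g0 gS] z Uz.
rewrite !derive1Sn -IHn //; apply: eq_derive1n => // w Uw.
by apply: is_derive1E; apply: is_derive_add; apply: derivable_is_derive1; [exact: f0|exact: g0].
Qed.

End DerivableUpto.

Section Leibniz.
Variables (K : numFieldType) (V : normedModType K) (U : set K).
Hypothesis oU : open U.
Implicit Types (f g : K -> V) (mu : K -> K) (z : K).

Lemma derivable_uptoZ n mu f : derivable_upto U n mu -> derivable_upto U n f ->
  derivable_upto U n (fun w => mu w *: f w).
Proof.
elim: n mu f => [|n IHn] mu f; first by [].
move=> Hmu Hf; have mun := derivable_upto_leq (leqnSn n) Hmu.
have fn := derivable_upto_leq (leqnSn n) Hf.
move: Hmu Hf => /derivable_uptoS[mu0 muS] /derivable_uptoS[f0 fS]; apply/derivable_uptoS.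
have d z : U z -> is_derive z 1 (fun w => mu w *: f w)
    (derive1 mu z *: f z + mu z *: derive1 f z).
  by move=> Uz; apply: is_derive_scale; apply: derivable_is_derive1; [exact: mu0|exact: f0].
split=> [z /d[]//|].
apply: (eq_derivable_upto oU (f := fun w => derive1 mu w *: f w + mu w *: derive1 f w)).
  by move=> z /d/is_derive1E.
by apply: (derivable_uptoD oU); apply: IHn.
Qed.

(* Only the triangular shape and the diagonal coefficient of the Leibniz
   formula matter for determinants. *)
Lemma leibniz_triangular n mu f : derivable_upto U n mu -> derivable_upto U n f ->
  forall z, U z -> exists a : nat -> K,
    derive1n n (fun w => mu w *: f w) z =
      mu z *: derive1n n f z + \sum_(i < n) a i *: derive1n i f z.
Proof.
elim: n mu f => [|n IHn] mu f Hmu Hf z Uz.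
  by exists (fun=> 0); rewrite big_ord0 addr0.
have mun := derivable_upto_leq (leqnSn n) Hmu.
have fn := derivable_upto_leq (leqnSn n) Hf.
move: Hmu Hf => /derivable_uptoS[mu0 muS] /derivable_uptoS[f0 fS].
have -> : derive1n n.+1 (fun w => mu w *: f w) z =
    derive1n n (fun w => derive1 mu w *: f w) z +
    derive1n n (fun w => mu w *: derive1 f w) z.
  rewrite -(derive1n_add oU) //; try exact: derivable_uptoZ.
  rewrite derive1Sn; apply: (eq_derive1n oU) => // w Uw.
  by apply: is_derive1E; apply: is_derive_scale; apply: derivable_is_derive1; [exact: mu0|exact: f0].
have [a ->] := IHn _ _ muS fn z Uz.
have [b ->] := IHn _ _ mun fS z Uz.
(* The leading term of the derivatives of [derive1 mu *: f] has order [n] in [f], now one below the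
   top. The coefficients [b] multiply derivatives of [derive1 f], so they move up by one index. *)
exists (fun i => (if i == n then derive1 mu z else a i) +
  (if i is j.+1 then b j else 0)).
rewrite -derive1Sn addrCA; congr (_ + _).
under [RHS]eq_bigr do rewrite scalerDl.
rewrite big_split /= big_ord_recr /= eqxx; congr (_ + _).
  by rewrite addrC; congr (_ + _); apply: eq_bigr => i _; rewrite ltn_eqF.
by rewrite big_ord_recl /= scale0r add0r; apply: eq_bigr => i _; rewrite -derive1Sn.
Qed.

End Leibniz.

Section DerivableUptoField.
Variables (K : numFieldType) (U : set K).
Hypothesis oU : open U.
Implicit Types (f g : K -> K).

Lemma derivable_uptoM n f g : derivable_upto U n f -> derivable_upto U n g ->
  derivable_upto U n (fun w => f w * g w).
Proof. exact: (@derivable_uptoZ K K U oU n f g). Qed.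

Lemma derivable_upto_sum n (I : Type) (s : seq I) (P : pred I) (F : I -> K -> K) :
  (forall i, derivable_upto U n (F i)) ->
  derivable_upto U n (fun w => \sum_(i <- s | P i) F i w).
Proof.
move=> HF; elim: s => [|i s IHs].
  rewrite (_ : (fun w => _) = fun=> 0); first exact: derivable_upto_cst.
  by apply/funext => w; rewrite big_nil.
case Pi : (P i).
  rewrite (_ : (fun w => _) = fun w => F i w + \sum_(i <- s | P i) F i w).
    exact: (derivable_uptoD oU (HF i) IHs).
  by apply/funext => w; rewrite big_cons Pi.
rewrite (_ : (fun w => _) = fun w => \sum_(i <- s | P i) F i w) //.
by apply/funext => w; rewrite big_cons Pi.
Qed.

Lemma derivable_upto_prod n (I : Type) (s : seq I) (F : I -> K -> K) :
  (forall i, derivable_upto U n (F i)) ->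
  derivable_upto U n (fun w => \prod_(i <- s) F i w).
Proof.
move=> HF; elim: s => [|i s IHs].
  rewrite (_ : (fun w => _) = fun=> 1); first exact: derivable_upto_cst.
  by apply/funext => w; rewrite big_nil.
rewrite (_ : (fun w => _) = fun w => F i w * \prod_(i <- s) F i w).
  exact: derivable_uptoM (HF i) IHs.
by apply/funext => w; rewrite big_cons.
Qed.

Lemma derivable_upto_det n m (M : K -> 'M[K]_m) :
  (forall i j, derivable_upto U n (fun w => M w i j)) ->
  derivable_upto U n (fun w => \det (M w)).
Proof.
move=> HM; apply: derivable_upto_sum => s; apply: derivable_uptoM.
  exact: derivable_upto_cst.
by apply: derivable_upto_prod => i; exact: HM.
Qed.

Lemma is_derive_inv f z df : f z != 0 -> is_derive z 1 f df ->
  is_derive z 1 (fun w => (f w)^-1) (- (df * ((f z)^-1 * (f z)^-1))).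
Proof.
move=> fz [fd fl]; split; first exact: derivableV.
by rewrite deriveV // fl expr2 scaleNr invfM [df * _]mulrC.
Qed.

Lemma derivable_uptoV n f : (forall z, U z -> f z != 0) ->
  derivable_upto U n f -> derivable_upto U n (fun w => (f w)^-1).
Proof.
move=> fN0; elim: n => [|n IHn] Hf; first exact: derivable_upto0.
have fn := derivable_upto_leq (leqnSn n) Hf.
move: Hf => /derivable_uptoS[f0 fS]; apply/derivable_uptoS.
have d z : U z -> is_derive z 1 (fun w => (f w)^-1)
    (- (derive1 f z * ((f z)^-1 * (f z)^-1))).
  by move=> Uz; apply: is_derive_inv; [exact: fN0|apply: derivable_is_derive1; exact: f0].
split=> [z /d[]//|].
apply: (eq_derivable_upto oU (f := fun w => (-1) * (derive1 f w * ((f w)^-1 * (f w)^-1)))).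
  by move=> z /d/is_derive1E ->; rewrite mulN1r.
apply: derivable_uptoM; first exact: derivable_upto_cst.
have Vn := IHn fn; exact: derivable_uptoM fS (derivable_uptoM Vn Vn).
Qed.

End DerivableUptoField.

(** * Vector-valued functions on the disc *)

Section VectorDerivatives.
Variables (K : numFieldType) (m : nat).
Implicit Types (f : K -> 'cV[K]_m.+1) (z : K).

Lemma is_derive_coord f z df i : is_derive z 1 f df ->
  is_derive z 1 (fun w => f w i 0) (df i 0).
Proof.
move=> /is_derive_slope[P [cP <- fP]].
apply: (@forall_slope_is_derive K K (fun w => f w i 0) (fun w => P w i 0)).
  apply: (@continuous_comp K 'cV[K]_m.+1 K P (fun M => M i 0)); first exact: cP.
  exact: coord_continuous.
by move=> w; rewrite fP !mxE.
Qed.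

Lemma is_derive_bigsum (V : normedModType K) (I : Type) (s : seq I) (F : I -> K -> V)
    (dF : I -> V) z : (forall i, is_derive z 1 (F i) (dF i)) ->
  is_derive z 1 (fun w => \sum_(i <- s) F i w) (\sum_(i <- s) dF i).
Proof.
move=> HF; elim: s => [|i s IHs].
  rewrite big_nil (_ : (fun w => _) = cst 0); first exact: is_derive_cst.
  by apply/funext => w; rewrite big_nil.
rewrite big_cons (_ : (fun w => _) = fun w => F i w + \sum_(i <- s) F i w).
  exact: is_derive_add (HF i) IHs.
by apply/funext => w; rewrite big_cons.
Qed.

Lemma mulmx_colE (L : 'M[K]_m.+1) (v : 'cV[K]_m.+1) :
  L *m v = \sum_j v j 0 *: col j L.
Proof.
apply/matrixP => i k; rewrite mxE summxE; apply: eq_bigr => j _.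
by rewrite !mxE (ord1 k) mulrC.
Qed.

Lemma is_derive_mulmx (L : 'M[K]_m.+1) f z df : is_derive z 1 f df ->
  is_derive z 1 (fun w => L *m f w) (L *m df).
Proof.
move=> Hf; rewrite mulmx_colE.
rewrite (_ : (fun w => _) = fun w => \sum_j f w j 0 *: col j L); last first.
  by apply/funext => w; rewrite mulmx_colE.
apply: is_derive_bigsum => j.
have := is_derive_scale (is_derive_coord j Hf) (is_derive_cst (col j L) z 1).
by rewrite scaler0 addr0.
Qed.

(* [derive1] is the junk value [point = 0] where [f] is not derivable. *)
Lemma derive1_notderivable f z : ~ derivable f z 1 -> derive1 f z = 0.
Proof.
move=> nf; rewrite derive1E /derive dvgP //.
by apply/matrixP => i j; rewrite !mxE.
Qed.

(** Derivability is no hypothesis here: by invertibility of [L] both functions are derivable at the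
    same points, and elsewhere both sides take the default value 0, which [L] fixes. *)
Lemma derive1n_mulmx (L : 'M[K]_m.+1) f n z : L \in unitmx ->
  derive1n n (fun w => L *m f w) z = L *m derive1n n f z.
Proof.
move=> uL; suff H : derive1n n (fun w => L *m f w) = fun w => L *m derive1n n f w.
  by rewrite H.
elim: n => [//|n IHn]; rewrite !derive1nS IHn; move: (derive1n n f) => g.
apply/funext => w; have [gd|ngd] := pselect (derivable g w 1).
  by apply: is_derive1E; apply: is_derive_mulmx; exact: derivable_is_derive1.
rewrite (derive1_notderivable ngd) mulmx0; apply: derive1_notderivable => Lgd.
apply: ngd; have := is_derive_mulmx (invmx L) (derivable_is_derive1 Lgd).
have -> : (fun w => invmx L *m (L *m g w)) = g by apply/funext => v; rewrite mulKmx.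
by move=> Hg; exact: (@ex_derive _ _ _ _ _ _ _ Hg).
Qed.

(* A free family does not contain the junk value [0]. *)
Lemma free_derive1n_derivable_upto (U : set K) f n :
  (forall z, U z -> free [seq derive1n k f z | k <- iota 0 n.+1]) ->
  derivable_upto U n f.
Proof.
move=> Hf k kn z Uz; have [//|/derive1_notderivable f0] := pselect (derivable (derive1n k f) z 1).
have : derive1n k.+1 f z \in [seq derive1n k f z | k <- iota 0 n.+1].
  by apply: (map_f (fun k => derive1n k f z)); rewrite mem_iota add0n ltnS.
by rewrite derive1nS f0 => /(free_not0 (Hf z Uz)); rewrite eqxx.
Qed.

Variable U : set K.
Hypothesis oU : open U.

Lemma derive1n_coord n f i : derivable_upto U n f -> forall z, U z ->
  derive1n n f z i 0 = derive1n n (fun w => f w i 0) z.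
Proof.
elim: n f => [//|n IHn] f /derivable_uptoS[f0 fS] z Uz.
rewrite !derive1Sn IHn //; apply: (eq_derive1n oU) => // w Uw.
by apply/esym/is_derive1E/is_derive_coord/derivable_is_derive1/f0.
Qed.

Lemma derivable_upto_coord n f i : derivable_upto U n f ->
  derivable_upto U n (fun w => f w i 0).
Proof.
elim: n f => [//|n IHn] f /derivable_uptoS[f0 fS]; apply/derivable_uptoS.
have d z : U z -> is_derive z 1 (fun w => f w i 0) (derive1 f z i 0).
  by move=> Uz; apply/is_derive_coord/derivable_is_derive1/f0.
split=> [z /d[]//|].
apply: (eq_derivable_upto oU (f := fun w => derive1 f w i 0)); last exact: IHn.
by move=> z /d/is_derive1E.
Qed.

End VectorDerivatives.

Section UnitDisc.
Variable R : realType.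
Local Notation C := (cplx R).
Local Notation D := (unit_disc (R := R)).

Lemma unit_discE (z : C) : D z <-> cabs z < 1.
Proof. by rewrite /unit_disc /= cabsE ltcR. Qed.

Lemma open_unit_disc : open D.
Proof.
rewrite openE => z /unit_discE z1; apply/near_realP.
exists (1 - cabs z); first by rewrite subr_gt0.
move=> w wz; apply/unit_discE; have := cabsD z (w - z).
rewrite addrC subrK; lra.
Qed.

(** Two complex derivatives give an expansion at every point, and expansions on a closed disc around
    [a] give all derivatives at [a]. The radius is half the distance to the unit circle, so that
    this disc stays inside. *)
Lemma derivable_upto2_smooth (f : C -> C) n :
  derivable_upto D 2 f -> derivable_upto D n f.
Proof.
move=> Hf k _ a /unit_discE a1.
pose r := (1 - cabs a) / 2.
have r0 : 0 < r by rewrite divr_gt0 // subr_gt0.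
apply: (@expansion2_derivable_derive1n _ f a r) => // z zr.
have Dz : D z.
  apply/unit_discE; have := cabsD a (z - a).
  rewrite addrC subrK; rewrite /r in zr r0; lra.
apply: derivable2_expansion2; last exact: (Hf 1%N).
by apply: filterS (near_open open_unit_disc Dz) => w; exact: (Hf 0%N).
Qed.

Lemma derive1_eq0_constant (t : C -> C) :
  (forall z, D z -> derivable t z 1) -> (forall z, D z -> derive1 t z = 0) ->
  forall z, D z -> t z = t 0.
Proof.
move=> td t0 z Dz; apply/eqP; rewrite -subr_eq0 -normr_le0.
have := @mean_value_norm_le R t 0 z 0.
rewrite add0r rmorph0 mul0r; apply => s /andP[s0 s1].
have Ds : D (0 + real_complex R s * z).
  apply/unit_discE; move/unit_discE: Dz => z1.
  rewrite add0r cabsM cabs_real ger0_norm //.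
  by apply: le_lt_trans z1; rewrite ler_piMl // cabs_ge0.
by split; [exact: td | rewrite t0 // normr0].
Qed.

Lemma is_derive_mul (f g : C -> C) (z df dg : C) : is_derive z 1 f df ->
  is_derive z 1 g dg -> is_derive z 1 (fun w => f w * g w) (df * g z + f z * dg).
Proof. exact: is_derive_scale. Qed.

Lemma is_derive_expn (f : C -> C) (z df : C) k : is_derive z 1 f df ->
  is_derive z 1 (fun w => f w ^+ k.+1) (k.+1%:R * f z ^+ k * df).
Proof.
move=> Hf; elim: k => [|k IHk].
  by rewrite expr0 mulr1 mul1r.
rewrite (_ : (fun w => _) = fun w => f w ^+ k.+1 * f w); last first.
  by apply/funext => w; rewrite exprSr.
have -> : k.+2%:R * f z ^+ k.+1 * df =
    k.+1%:R * f z ^+ k * df * f z + f z ^+ k.+1 * df.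
  by rewrite -[k.+2%:R]natr1 exprSr; ring.
exact: is_derive_mul IHk Hf.
Qed.

(** Differentiating [lam ^+ m.+1 * W = 1] gives [lam' = - lam W' / ((m+1) W)], so each order of
    derivability of [lam] yields the next one as far as [W] permits. *)
Lemma root_derivable_upto (lam W : C -> C) m n :
  (forall z, D z -> derivable lam z 1) ->
  (forall z, D z -> lam z != 0 /\ lam z ^+ m.+1 * W z = 1) ->
  derivable_upto D n W -> derivable_upto D n lam.
Proof.
have oD : open D := @open_unit_disc.
move=> dlam lamW; elim: n => [|n IHn] HW; first exact: derivable_upto0.
have Wn := derivable_upto_leq (leqnSn n) HW.
have W0 z : D z -> W z != 0.
  by move=> /lamW[_]; apply: contra_eq_neq => ->; rewrite mulr0 eq_sym oner_eq0.
move: HW => /derivable_uptoS[dW HW']; apply/derivable_uptoS; split; first exact: dlam.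
pose g (z : C) : C := (- (m.+1%:R)^-1) * (lam z * (derive1 W z * (W z)^-1)).
refine (@eq_derivable_upto C C D oD n g (derive1 lam) _ _).
  move=> z Dz; have [lam0 lamWz] := lamW z Dz.
  have dl := derivable_is_derive1 (dlam z Dz).
  have H := is_derive_mul (is_derive_expn m dl) (derivable_is_derive1 (dW z Dz)).
  have : derive1 (fun w => lam w ^+ m.+1 * W w) z = 0.
    have E1 w : D w -> lam w ^+ m.+1 * W w = 1 by move=> /lamW[].
    transitivity (derive1 (fun _ : C => 1 : C) z).
      exact: (@eq_derive1n C C D oD _ _ E1 1%N z Dz).
    exact: derive1_cst.
  rewrite /g (is_derive1E H) exprSr; move: (derive1 lam z) (derive1 W z) => l' W' E.
  have Wz := W0 z Dz; have lm : lam z ^+ m != 0 by rewrite expf_neq0.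
  have mn : m.+1%:R != 0 :> C by rewrite pnatr_eq0.
  apply: (mulfI lm); apply: (mulfI Wz); apply: (mulfI mn).
  have -> : m.+1%:R * (W z * (lam z ^+ m * l')) =
    - (lam z ^+ m * lam z * W') by apply/eqP; rewrite -addr_eq0 -[X in _ == X]E; apply/eqP; ring.
  move: (m.+1%:R) mn => c mn; field; by rewrite Wz mn.
have lamn := IHn Wn.
have WVn := derivable_uptoV oD W0 Wn.
have lamW' := derivable_uptoM oD lamn (derivable_uptoM oD HW' WVn).
have cn := @derivable_upto_cst C C D n (- (m.+1%:R)^-1).
exact: (@derivable_uptoM C D oD n _ _ cn lamW').
Qed.

End UnitDisc.

(** * Wronskians and curvatures *)

Section Curvatures.
Variables (R : realType) (n : nat).
Local Notation C := (cplx R).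
Local Notation D := (unit_disc (R := R)).
Local Notation V := 'cV[cplx R]_n.+1.
Implicit Types (f g : C -> V) (mu lam : C -> C).

Let oD : open D := @open_unit_disc R.

Lemma derivable_upto_derive1n (W : normedModType C) (h : C -> W) j k :
  derivable_upto D (j + k) h -> derivable_upto D k (derive1n j h).
Proof.
move=> Hh i ik z Dz; rewrite /derive1n -iterD.
by apply: (Hh (i + j)%N _ z Dz); lia.
Qed.

Lemma derivable_upto_mulmx (L : 'M[C]_n.+1) f k : L \in unitmx ->
  derivable_upto D k f -> derivable_upto D k (fun w => L *m f w).
Proof.
move=> uL Hf i ik z Dz.
have -> : derive1n i (fun w => L *m f w) = fun w => L *m derive1n i f w.
  by apply/funext => w; exact: derive1n_mulmx.
have Hd := is_derive_mulmx L (derivable_is_derive1 (Hf i ik z Dz)).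
exact: (@ex_derive _ _ _ _ _ _ _ Hd).
Qed.

Lemma holomorphic_derivable_upto1 (W : normedModType C) (h : C -> W) :
  holomorphic_on_disc h -> derivable_upto D 1 h.
Proof. by move=> hh [_ z Dz|k k1]; [exact: hh | case: (notF k1)]. Qed.

(** Serves the case [n = 0]: there [derivable_upto D n] says nothing, yet the factor [mu] has to be
    derivable once for a constancy argument. *)
Lemma derivable_upto_max1 (W : normedModType C) (h : C -> W) k :
  holomorphic_on_disc h -> derivable_upto D k h -> derivable_upto D (maxn k 1) h.
Proof.
move=> h1; case: k => [_|k Hk]; first exact: holomorphic_derivable_upto1.
by rewrite (maxn_idPl _).
Qed.

Lemma wronskian_mulmx (L : 'M[C]_n.+1) f z : L \in unitmx ->
  wronskian_mx (fun w => L *m f w) z = L *m wronskian_mx f z.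
Proof.
move=> uL; apply/matrixP => i j; rewrite mxE derive1n_mulmx // !mxE.
by apply: eq_bigr => k _; rewrite mxE.
Qed.

Lemma eq_wronskian f g z : (forall w, D w -> f w = g w) -> D z ->
  wronskian_mx f z = wronskian_mx g z.
Proof.
move=> fg Dz; apply/matrixP => i j; rewrite !mxE.
by rewrite (eq_derive1n oD fg j Dz).
Qed.

(** By the Leibniz formula the Wronskian matrix of [mu *: f] is that of [f] times an upper
    triangular matrix with [mu z] all along the diagonal. *)
Lemma det_wronskian_scale mu f z : derivable_upto D n mu -> derivable_upto D n f ->
  D z -> \det (wronskian_mx (fun w => mu w *: f w) z) =
    mu z ^+ n.+1 * \det (wronskian_mx f z).
Proof.
move=> Hmu Hf Dz.
have /choice[a Ha] : forall j : 'I_n.+1, exists a : nat -> C,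
    derive1n j (fun w => mu w *: f w) z =
    mu z *: derive1n j f z + \sum_(i < j) a i *: derive1n i f z.
  move=> j; have jn : (j <= n)%N by rewrite -ltnS.
  apply: (leibniz_triangular oD) => //; exact: derivable_upto_leq jn _.
pose T : 'M[C]_n.+1 := \matrix_(i, j)
  if (i < j)%N then a j i else if i == j then mu z else 0.
have -> : wronskian_mx (fun w => mu w *: f w) z = wronskian_mx f z *m T.
  apply/matrixP => i j; rewrite !mxE Ha !mxE (bigD1 j) //= !mxE ltnn eqxx mulrC.
  congr (_ + _); have jn : (j <= n.+1)%N by exact: ltnW.
  rewrite summxE (big_ord_widen _ (fun k => (a j k *: derive1n k f z) i 0) jn).
  rewrite big_mkcond [RHS]big_mkcond; apply: eq_bigr => k _; rewrite !mxE.
  case: ltngtP => [kj|kj|/val_inj ->]; last by rewrite eqxx.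
    by rewrite ifT 1?mulrC //; apply: contraTneq kj => ->; rewrite ltnn.
  by case: eqVneq => // _; rewrite mulr0.
rewrite det_mulmx mulrC; congr (_ * _).
rewrite -det_tr det_trig; last first.
  apply/is_trig_mxP => i j ij; rewrite !mxE ltnNge (ltnW ij) /=.
  by rewrite ifF //; apply/negbTE; apply: contraTneq ij => ->; rewrite ltnn.
rewrite (eq_bigr (fun=> mu z)); last by move=> i _; rewrite !mxE ltnn eqxx.
by rewrite prodr_const card_ord.
Qed.

(** For [n >= 2] the coordinates of [f] are twice derivable, hence smooth, and the determinant is a
    polynomial in their derivatives. This is where [k] becomes arbitrary. *)
Lemma derivable_upto_det_wronskian f k : (1 < n)%N -> derivable_upto D n f ->
  derivable_upto D k (fun z => \det (wronskian_mx f z)).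
Proof.
move=> n1 Hf; apply: (derivable_upto_det oD) => i j.
have jn : (j <= n)%N by rewrite -ltnS.
have f2 := derivable_upto_coord (i := i) oD (derivable_upto_leq n1 Hf).
have fs := @derivable_upto2_smooth R (fun w => f w i 0) (j + k) f2.
apply: (eq_derivable_upto oD _ (derivable_upto_derive1n fs)) => z Dz.
by rewrite mxE (derive1n_coord oD i (derivable_upto_leq jn Hf)).
Qed.

Lemma normalizing_factor_derivable_upto f lam : derivable_upto D n f ->
  normalizing_factor f lam -> derivable_upto D n lam.
Proof.
move=> Hf [lam1 lamW]; have [n1|n1] := leqP n 1.
  exact: derivable_upto_leq n1 (holomorphic_derivable_upto1 lam1).
apply: (@root_derivable_upto R lam (fun z => \det (wronskian_mx f z)) n n lam1 lamW).
exact: derivable_upto_det_wronskian.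
Qed.

(** Near each point some coordinate of [g] does not vanish, and there [mu] is a quotient of
    coordinates. One derivative of [g] is used to know that the set of nonvanishing is open. *)
Lemma ratio_derivable_upto f g mu k : (0 < k)%N ->
  derivable_upto D k f -> derivable_upto D k g ->
  (forall z, D z -> g z != 0) -> (forall z, D z -> f z = mu z *: g z) ->
  derivable_upto D k mu.
Proof.
move=> k0 Hf Hg g0 fg j jk z Dz.
have /cV0Pn[i gi] := g0 z Dz.
pose U : set C := [set w | D w /\ g w i 0 != 0].
have Hgi := derivable_upto_coord (i := i) oD Hg.
have oU : open U.
  rewrite openE => w [Dw gw].
  have dw : derivable (fun w => g w i 0) w 1 := Hgi 0%N k0 w Dw.
  have cw : {for w, continuous (fun w => g w i 0)}.
    by apply: differentiable_continuous; exact/derivable1_diffP.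
  have gw0 : (0 : C) < `|g w i 0| by rewrite normr_gt0.
  have [d d0 dP] := (continuous_atP _ _).1 cw _ gw0.
  have nw : \forall v \near w, g v i 0 != 0.
    apply/nearP; exists d => // v /dP; apply: contraTneq => ->.
    by rewrite sub0r normrN ltxx.
  by apply: filterS (filterI (near_open oD Dw) nw) => v [].
have resU (h : C -> C) : derivable_upto D k h -> derivable_upto U k h.
  by move=> Hh l lk w [Dw _]; exact: Hh.
have Uz : U z by [].
have gV := derivable_uptoV oU (f := fun w => g w i 0) (fun w Uw => Uw.2) (resU _ Hgi).
have fgV := derivable_uptoM oU (resU _ (derivable_upto_coord (i := i) oD Hf)) gV.
have E w : U w -> f w i 0 * (g w i 0)^-1 = mu w.
  by move=> [Dw gw]; rewrite fg // mxE mulfK.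
exact: (eq_derivable_upto oU E fgV jk Uz).
Qed.

(** The derivative [(n+1) t^n t'] of the power vanishes and [t] has no zero because [c != 0], so
    [t' = 0]. *)
Lemma root_of_constant (t : C -> C) (c : C) : (forall z, D z -> derivable t z 1) ->
  (forall z, D z -> t z ^+ n.+1 = c) -> c != 0 -> forall z, D z -> t z = t 0.
Proof.
move=> td tc c0; apply: derive1_eq0_constant => // z Dz.
have H := is_derive_expn n (derivable_is_derive1 (td z Dz)).
have : derive1 (fun w => t w ^+ n.+1) z = 0.
  transitivity (derive1 (fun _ : C => c) z).
    exact: (@eq_derive1n C C D oD _ (fun=> c) tc 1%N z Dz).
  exact: derive1_cst.
rewrite (is_derive1E H) => /eqP; rewrite mulf_eq0 mulf_eq0 pnatr_eq0 /=.
have t0 : t z != 0 by apply: contra_neq c0 => t0; rewrite -(tc z Dz) t0 expr0n.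
by rewrite expf_eq0 (negbTE t0) andbF /= => /eqP.
Qed.

(** The differences [k i - k' i], completed by 0 for the missing derivative of order [n], form a
    vector in the kernel of the invertible Wronskian matrix. *)
Lemma wronskian_unique f (k k' : 'I_n -> C) z : wronskian_mx f z \in unitmx ->
  \sum_(i < n) k i *: derive1n i f z = \sum_(i < n) k' i *: derive1n i f z ->
  forall i, k i = k' i.
Proof.
move=> uW E.
pose v : 'cV[C]_n.+1 := \col_j oapp (fun i => k i - k' i) 0 (insub (val j)).
have vi (i : 'I_n) : v (widen_ord (leqnSn n) i) 0 = k i - k' i.
  by rewrite mxE /= valK.
have Wv : wronskian_mx f z *m v = 0.
  have v_max : v ord_max 0 = 0 by rewrite mxE insubN /= ?ltnn.
  apply/matrixP => a b; rewrite (ord1 b) [LHS]mxE [RHS]mxE big_ord_recr /= v_max.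
  rewrite mulr0 addr0; move/matrixP/(_ a 0): E; rewrite !summxE => /eqP.
  rewrite -subr_eq0 -sumrB => /eqP E; rewrite -[RHS]E; apply: eq_bigr => i _.
  by rewrite vi mxE [X in _ = X - _]mxE [X in _ = _ - X]mxE -mulrBl mulrC.
have v0 : v = 0 by rewrite -(mulKmx uW v) Wv mulmx0.
by move=> i; apply/eqP; rewrite -subr_eq0 -vi v0 mxE.
Qed.

(** The common core of the three claims. Derivability of [f2] is a hypothesis of its own because it
    has different sources: freeness for a nondegenerate lifting, differentiation of the formula for
    a linear or affine image. *)
Lemma curvatures_from_proportional f0 f2 (M : 'M[C]_n.+1) mu (kappa : 'I_n -> C -> C) :
  holomorphic_on_disc f0 -> nondegenerate_lifting f0 -> curvatures_from f0 kappa ->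
  holomorphic_on_disc f2 -> derivable_upto D n f2 -> M \in unitmx ->
  (forall z, D z -> mu z != 0 /\ f2 z = mu z *: (M *m f0 z)) ->
  forall kappa', curvatures_from f2 kappa' <-> equal_on_disc kappa' kappa.
Proof.
move=> h0 nd0 [lam0 Hlam0 K0] h2 Hf2 uM f2E kappa'.
have Hf0 : derivable_upto D n f0 := free_derive1n_derivable_upto nd0.
have [lam0h lam0W] := Hlam0.
pose g w := M *m f0 w.
have Hg : derivable_upto D n g := derivable_upto_mulmx uM Hf0.
have hg : holomorphic_on_disc g.
  move=> z Dz; have Hd := is_derive_mulmx M (derivable_is_derive1 (h0 z Dz)).
  exact: (@ex_derive _ _ _ _ _ _ _ Hd).
have f0N0 z : D z -> f0 z != 0.
  move=> Dz; apply: (free_not0 (nd0 z Dz)).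
  by apply: (map_f (fun k => derive1n k f0 z) (x := 0%N)); rewrite mem_iota.
have gN0 z : D z -> g z != 0.
  by move=> /f0N0; apply: contra_neq => gz; rewrite -(mulKmx uM (f0 z)) -/(g z) gz mulmx0.
have f2g z : D z -> f2 z = mu z *: g z by move=> /f2E[].
have muN0 z : D z -> mu z != 0 by move=> /f2E[].
have Hmu1 : derivable_upto D (maxn n 1) mu.
  apply: (ratio_derivable_upto _ (derivable_upto_max1 h2 Hf2)
    (derivable_upto_max1 hg Hg) gN0 f2g).
  by rewrite leq_max orbT.
have Hmu : derivable_upto D n mu := derivable_upto_leq (leq_maxl n 1) Hmu1.
have hmu : derivable_upto D 1 mu := derivable_upto_leq (leq_maxr n 1) Hmu1.
have hlam0 := holomorphic_derivable_upto1 lam0h.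
have detM : \det M != 0 by rewrite -unitfE -unitmxE.
have W2 z : D z -> \det (wronskian_mx f2 z) =
    mu z ^+ n.+1 * (\det M * \det (wronskian_mx f0 z)).
  move=> Dz; rewrite (eq_wronskian f2g Dz) (det_wronskian_scale Hmu Hg Dz).
  by rewrite (wronskian_mulmx f0 z uM) det_mulmx.
pose nu0 := normalized_lift lam0 f0.
have W0 z : D z -> wronskian_mx nu0 z \in unitmx.
  move=> Dz; have [_ E] := lam0W z Dz.
  have Hl := normalizing_factor_derivable_upto Hf0 Hlam0.
  rewrite /nu0 /normalized_lift unitmxE unitfE (det_wronskian_scale Hl Hf0 Dz) E.
  exact: oner_neq0.
have prop lam2 : normalizing_factor f2 lam2 -> exists2 c : C, c != 0 &
    forall z, D z -> normalized_lift lam2 f2 z = (c *: M) *m nu0 z.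
  move=> [lam2h lam2W].
  have hlam2 := holomorphic_derivable_upto1 lam2h.
  (* The normalized lifts differ by [t z *: M]; comparing the two normalizations forces
     [t z ^+ n.+1 = (\det M)^-1], hence [t] is constant. *)
  pose t z := lam2 z * mu z * (lam0 z)^-1.
  have ht : derivable_upto D 1 t.
    apply: (derivable_uptoM oD (derivable_uptoM oD hlam2 hmu)).
    apply: (derivable_uptoV oD) hlam0 => z Dz; exact: (lam0W z Dz).1.
  have tE z : D z -> t z ^+ n.+1 = (\det M)^-1.
    move=> Dz; have [l2 E2] := lam2W z Dz; have [l0 E0] := lam0W z Dz.
    rewrite W2 // in E2; apply: (mulIf detM); rewrite mulVf //.
    have W0N0 : \det (wronskian_mx f0 z) != 0.
      by apply: contra_eq_neq E0 => ->; rewrite mulr0 eq_sym oner_neq0.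
    have -> : t z ^+ n.+1 * \det M =
        (lam2 z ^+ n.+1 * (mu z ^+ n.+1 * (\det M * \det (wronskian_mx f0 z)))) /
        (lam0 z ^+ n.+1 * \det (wronskian_mx f0 z)).
      rewrite /t !exprMn exprVn; field; by rewrite W0N0 expf_neq0.
    by rewrite E2 E0 divr1.
  have tc := root_of_constant (ht 0%N isT) tE (invr_neq0 detM).
  have D0 : D 0 by rewrite /unit_disc /= normr0.
  exists (t 0).
    by rewrite mulf_neq0 ?invr_eq0 ?mulf_neq0 ?(lam2W 0 D0).1 ?muN0 ?(lam0W 0 D0).1.
  move=> z Dz; have tz : t 0 = t z := esym (tc z Dz).
  rewrite tz /normalized_lift /nu0 /normalized_lift (f2g z Dz) /g.
  rewrite -scalemxAl -scalemxAr !scalerA /t divfK //; exact: (lam0W z Dz).1.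
(* The constant invertible matrix [c *: M] commutes with derivation and cancels, so both normalized
   lifts obey an equation with the same coefficients. *)
have deriv lam2 (c : C) : c != 0 ->
    (forall z, D z -> normalized_lift lam2 f2 z = (c *: M) *m nu0 z) ->
    forall z, D z -> (derive1n n.+1 (normalized_lift lam2 f2) z =
        \sum_(i < n) kappa' i z *: derive1n i (normalized_lift lam2 f2) z <->
      forall i, kappa' i z = kappa i z).
  move=> c0 E z Dz.
  have ucM : c *: M \in unitmx by rewrite unitmxZ // unitfE.
  have dE k : derive1n k (normalized_lift lam2 f2) z = (c *: M) *m derive1n k nu0 z.
    by rewrite (eq_derive1n oD E) // derive1n_mulmx.
  rewrite dE (eq_bigr (fun i : 'I_n => (c *: M) *m (kappa' i z *: derive1n i nu0 z))); last first.
    by move=> i _; rewrite dE scalemxAr.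
  rewrite -mulmx_sumr (K0 z Dz) -/nu0; split=> [H|H].
    have {}H := can_inj (mulKmx ucM) H.
    by move=> i; apply/esym; exact: (wronskian_unique (W0 z Dz) H).
  by congr (_ *m _); apply: eq_bigr => i _; rewrite H.
split=> [[lam2 Hlam2 K2]|kk].
  have [c c0 cE] := prop _ Hlam2.
  by move=> i z Dz; apply: (deriv _ _ c0 cE z Dz).1; exact: K2.
(* A factor for [f2] must absorb both [mu] and [\det M]; the latter needs an (n+1)-st root, which
   exists in [C]. *)
have [d dE] : exists d : C, d ^+ n.+1 = \det M.
  by exists (n.+1.-root (\det M : complex R)); rewrite rootCK.
have dN0 : d != 0 by apply: contra_neq detM => d0; rewrite -dE d0 expr0n.
pose lam2 z := lam0 z * (mu z * d)^-1.
have mdN0 z : D z -> mu z * d != 0 by move=> Dz; rewrite mulf_neq0 ?muN0.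
have hd : derivable_upto D 1 (fun _ : C => d) := @derivable_upto_cst C C D 1 d.
have hlam2 : derivable_upto D 1 lam2.
  exact: (derivable_uptoM oD hlam0 (derivable_uptoV oD mdN0 (derivable_uptoM oD hmu hd))).
have Hlam2 : normalizing_factor f2 lam2.
  split=> [z Dz|z Dz]; first exact: (hlam2 0%N isT z Dz).
  have [l0 E0] := lam0W z Dz; split.
    by rewrite /lam2 mulf_neq0 // invr_eq0 mdN0.
  rewrite W2 // -E0 /lam2 exprMn exprVn exprMn dE.
  by field; rewrite detM expf_neq0 // muN0.
exists lam2 => // z Dz; have [c c0 cE] := prop _ Hlam2.
by apply: (deriv _ _ c0 cE z Dz).2 => i; exact: kk.
Qed.

Lemma vline_proportional (u v : V) : u != 0 -> <[u]>%VS = <[v]>%VS ->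
  exists k, k != 0 /\ u = k *: v.
Proof.
move=> u0 uv; have : u \in <[v]>%VS by rewrite -uv memv_line.
move=> /vlineP[k uE]; exists k; split=> //.
by apply: contra_neq u0 => k0; rewrite uE k0 scale0r.
Qed.

Lemma limg_mulmx_line (M : 'M[C]_n.+1) (u : V) :
  (linfun (mulmx M) @: <[u]>)%VS = <[M *m u]>%VS.
Proof. by rewrite limg_line lfunE. Qed.

Lemma free_map_mulmx (M : 'M[C]_n.+1) (s : seq V) : M \in unitmx ->
  free (map (linfun (mulmx M)) s) = free s.
Proof.
move=> uM; rewrite /free -limg_span limg_dim_eq ?size_map //.
have injM (u v : V) : linfun (mulmx M) u = linfun (mulmx M) v -> u = v.
  by rewrite !lfunE /= => uv; rewrite -(mulKmx uM u) uv mulKmx.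
rewrite [X in (_ :&: X)%VS](_ : _ = 0%VS) ?capv0 //.
by apply/eqP/lker0P => u v; exact: injM.
Qed.

End Curvatures.

Theorem theorem4p2 (R : realType) (n : nat)
    (Phi : cplx R -> projective_space R n)
    (f : cplx R -> 'cV[cplx R]_n.+1)
    (hf : is_lifting Phi f) (hfree : nondegenerate_lifting f)
    (kappa : 'I_n -> cplx R -> cplx R)
    (hkappa : schwarzian_curvatures Phi kappa) :
  [/\ forall P : projective_space R n -> projective_space R n,
        projective_transformation P ->
        forall kappa' : 'I_n -> cplx R -> cplx R,
          schwarzian_curvatures (P \o Phi) kappa' <->
          equal_on_disc kappa' kappa,
      forall L : 'M[cplx R]_n.+1, L \in unitmx ->
        forall kappa' : 'I_n -> cplx R -> cplx R,
          curvatures_from (fun z => L *m f z) kappa' <->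
          equal_on_disc kappa' kappa
    & forall (A : 'cV[cplx R]_n.+1 -> 'cV[cplx R]_n.+1)
             (P : projective_space R n -> projective_space R n),
        affine_nonsingular A -> projective_transformation P ->
        is_lifting (P \o Phi) (A \o f) ->
        forall kappa' : 'I_n -> cplx R -> cplx R,
          curvatures_from (A \o f) kappa' <->
          equal_on_disc kappa' kappa].
Proof.
have [f0 [[h0 l0] nd0 K0]] := hkappa.
have [hh hl] := hf.
have Hf := free_derive1n_derivable_upto hfree.
pose D := unit_disc (R := R).
have proportional (P : projective_space R n -> projective_space R n)
    (M : 'M[cplx R]_n.+1) f2 :
    (forall l, val (P l) = (linfun (mulmx M) @: val l)%VS) ->
    is_lifting (P \o Phi) f2 ->
    exists mu : cplx R -> cplx R, forall z, D z ->
      mu z != 0 /\ f2 z = mu z *: (M *m f0 z).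
  move=> PM [_ l2].
  suff /choice[mu muP] : forall z, exists k : cplx R, D z ->
    k != 0 /\ f2 z = k *: (M *m f0 z) by exists mu.
  move=> z; have [Dz|nDz] := pselect (D z); last by exists 0.
  have [f2N0 f2l] := l2 z Dz; have [_ f0l] := l0 z Dz.
  have [|k kP] := @vline_proportional R n (f2 z) (M *m f0 z) f2N0.
    by rewrite -f2l /= PM f0l limg_mulmx_line.
  by exists k.
split.
- move=> P [M uM PM] kappa'; split.
    move=> [f2 [lift2 nd2 K2]].
    have [mu muP] := proportional P M f2 PM lift2.
    have Hf2 := free_derive1n_derivable_upto nd2.
    by apply/(curvatures_from_proportional h0 nd0 K0 lift2.1 Hf2 uM muP).
  (* The image of [f0] under the matrix of [P] is a nondegenerate lifting of the transformed curve,
     proportional to itself with [mu = 1]. *)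
  move=> kk; exists (fun z => M *m f0 z).
  have hM : holomorphic_on_disc (fun z => M *m f0 z).
    move=> z Dz; have Hd := is_derive_mulmx M (derivable_is_derive1 (h0 z Dz)).
    exact: (@ex_derive _ _ _ _ _ _ _ Hd).
  have Hf0 := free_derive1n_derivable_upto nd0.
  split.
  + split=> // z Dz; have [f0N0 f0l] := l0 z Dz; split.
      by apply: contra_neq f0N0 => E; rewrite -(mulKmx uM (f0 z)) E mulmx0.
    by rewrite /= PM f0l limg_mulmx_line.
  + move=> z Dz; have E k : derive1n k (fun z => M *m f0 z) z = linfun (mulmx M) (derive1n k f0 z).
      by rewrite derive1n_mulmx // lfunE.
    by rewrite (eq_map E) map_comp free_map_mulmx //; exact: nd0.
  + have mu1 z : D z -> (1 : cplx R) != 0 /\ M *m f0 z = 1 *: (M *m f0 z).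
      by move=> _; rewrite oner_neq0 scale1r.
    have Mf0 := derivable_upto_mulmx uM Hf0.
    by apply/(curvatures_from_proportional h0 nd0 K0 hM Mf0 uM mu1).
- move=> L uL kappa'.
  (* [f] and [f0] span the same lines because they lift the same curve; [L] preserves the factor
     between them. *)
  have /choice[mu muP] : forall z, exists k : cplx R, D z ->
      k != 0 /\ L *m f z = k *: (L *m f0 z).
    move=> z; have [Dz|nDz] := pselect (D z); last by exists 0.
    have [fN0 fl] := hl z Dz; have [_ f0l] := l0 z Dz.
    have [|k [k0 kE]] := @vline_proportional R n (f z) (f0 z) fN0; first by rewrite -fl.
    by exists k; rewrite kE scalemxAr.
  apply: (curvatures_from_proportional h0 nd0 K0 _ _ uL muP).
    move=> z Dz; have Hd := is_derive_mulmx L (derivable_is_derive1 (hh z Dz)).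
    exact: (@ex_derive _ _ _ _ _ _ _ Hd).
  exact: derivable_upto_mulmx.
- move=> A P [L [b [uL AE]]] [M uM PM] lift2.
  have [mu muP] := proportional P M (A \o f) PM lift2.
  (* The matrix of comparison is the [M] of [P], since [A \o f] lifts [P \o Phi]; [L] and [b] serve
     to differentiate [A \o f] up to order [n]. *)
  apply: (curvatures_from_proportional h0 nd0 K0 lift2.1 _ uM muP).
  rewrite (_ : A \o f = fun z => L *m f z + b); last by apply/funext => z; rewrite /= AE.
  apply: (derivable_uptoD (@open_unit_disc R)); first exact: derivable_upto_mulmx.
  exact: derivable_upto_cst.
Qed.
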